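(* Let $K$ be a commutative ring, let $R$ be a $K$-algebra, let $\Lambda$ be a left noetherian subalgebra of $R$, let $s$ be a positive integer and let $q_{ji}\in\Lambda$ for $1\le i<j\le s$. The following statements are equivalent: (i) There is an admissible order $\preceq$ on some $\mathbb{N}^n$ and an $(\mathbb{N}^n,\preceq)$-filtration $F=\{F_\alpha(R)\mid \alpha\in\mathbb{N}^n\}$ on $R$ such that $F_0(R)=\Lambda$, every $F_\alpha(R)$ is finitely generated as a left $\Lambda$-module, and $G^F(R)=\Lambda[y_1;\sigma_1]\cdots[y_s;\sigma_s]$ is an $\mathbb{N}^n$-graded iterated Ore extension for some homogeneous elements $y_1,\dots,y_s$ such that $\sigma_j(y_i)=q_{ji}y_i$ for every $1\le i<j\le s$. (ii) There is an $\mathbb{N}$-filtration $\{R_n\mid n\in\mathbb{N}\}$ on $R$ such that $R_0=\Lambda$, every $R_n$ is finitely generated as a left $\Lambda$-module, and the associated graded algebra $\operatorname{gr}(R)=\Lambda[y_1;\sigma_1]\cdots[y_s;\sigma_s]$ is an $\mathbb{N}$-graded iterated Ore extension for some homogeneous elements $y_1,\dots,y_s$ such that $\sigma_j(y_i)=q_{ji}y_i$ for every $1\le i<j\le s$. (iii) There are elements $x_1,\dots,x_s\in R$, an admissible order $\preceq'$ on $\mathbb{N}^s$, and finite subsets $\Gamma_{ji},\Gamma_k\subseteq\mathbb{N}^s$ ($1\le i<j\le s$, $1\le k\le s$) such that every $\gamma\in\Gamma_{ji}$ satisfies $\gamma\prec'\epsilon_i+\epsilon_j$ and every $\gamma\in\Gamma_k$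 satisfies $\gamma\prec'\epsilon_k$, such that the standard monomials $\{x^\alpha=x_1^{\alpha_1}\cdots x_s^{\alpha_s}\mid \alpha\in\mathbb{N}^s\}$ form a basis of $R$ as a left $\Lambda$-module, and such that $x_jx_i=q_{ji}x_ix_j+\sum_{\alpha\in\Gamma_{ji}}c_\alpha x^\alpha$ for all $1\le i<j\le s$ (with $c_\alpha\in\Lambda$), and for every $a\in\Lambda$ and every $k$ there is $a^{(k)}\in\Lambda$ with $x_ka=a^{(k)}x_k+\sum_{\alpha\in\Gamma_k}c_\alpha x^\alpha$ (with $c_\alpha\in\Lambda$).
   Context: $\mathbb{N}^n$ is the free abelian monoid on $\epsilon_1,\dots,\epsilon_n$ (vectors with nonnegative integer entries). An admissible order on $\mathbb{N}^n$ is a total order compatible with addition such that $0\preceq\alpha$ for all $\alpha$. An $(\mathbb{N}^n,\preceq)$-filtration on a $K$-algebra $R$ is a family $\{F_\alpha(R)\}_{\alpha\in\mathbb{N}^n}$ of $K$-submodules with $F_\alpha(R)\subseteq F_\beta(R)$ for $\alpha\preceq\beta$, $F_\alpha(R)F_\beta(R)\subseteq F_{\alpha+\beta}(R)$, $\bigcup_\alpha F_\alpha(R)=R$ and $1\in F_0(R)$. The associated $\mathbb{N}^n$-graded algebra is $G^F(R)=\bigoplus_\alpha F_\alpha(R)/F_{\prec\alpha}(R)$, where $F_{\prec\alpha}(R)=\bigcup_{\beta\prec\alpha}F_\beta(R)$; for $n=1$ (usual order) this is the usual associated graded algebra $\operatorname{gr}(R)$ of a positive filtration. $\Lambda$ is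 identified with the degree-zero part of the associated graded algebra. $\Lambda[y_1;\sigma_1]\cdots[y_s;\sigma_s]$ denotes an iterated Ore extension without derivations: $\sigma_j$ is a ring endomorphism of $\Lambda[y_1;\sigma_1]\cdots[y_{j-1};\sigma_{j-1}]$ and $y_jr=\sigma_j(r)y_j$ for all $r$ in that ring. *)

(* Defs.v *)
From HB Require Import structures.
From mathcomp Require Import all_boot all_order all_algebra.
Set Implicit Arguments. Unset Strict Implicit. Unset Printing Implicit Defensive.
Import Order.TTheory GRing.Theory Num.Theory.
Local Open Scope ring_scope.

Definition Nn (n : nat) := {ffun 'I_n -> nat}.
Definition Nn_add n (a b : Nn n) : Nn n := [ffun i => (a i + b i)%N].
Definition Nn_zero n : Nn n := [ffun _ => 0%N].
Definition Nn_eps n (i : 'I_n) : Nn n := [ffun k => nat_of_bool (k == i)].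

Definition strict (M : Type) (le : M -> M -> Prop) (a b : M) : Prop :=
  le a b /\ a <> b.

Definition admissible (M : Type) (add : M -> M -> M) (z : M)
  (le : M -> M -> Prop) : Prop :=
  (forall a, le a a) /\
  (forall a b, le a b -> le b a -> a = b) /\
  (forall a b c, le a b -> le b c -> le a c) /\
  (forall a b, le a b \/ le b a) /\
  (forall a b c, le a b -> le (add a c) (add b c)) /\
  (forall a, le z a).

Section Alg.
Variables (K : comPzRingType) (R : algType K).

Definition Ksubmodule (P : R -> Prop) : Prop :=
  [/\ P 0, (forall x y, P x -> P y -> P (x + y)) &
      (forall (k : K) x, P x -> P (k *: x))].

Definition subalgebra (L : R -> Prop) : Prop :=
  [/\ Ksubmodule L, L 1 & (forall x y, L x -> L y -> L (x * y))].

Definition fg_left (L P : R -> Prop) : Prop :=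
  exists (m : nat) (g : 'I_m -> R), (forall k, P (g k)) /\
    forall x, P x <-> exists c : 'I_m -> R,
                        (forall k, L (c k)) /\ x = \sum_(k < m) c k * g k.

Definition left_ideal_of (L I : R -> Prop) : Prop :=
  [/\ (forall x, I x -> L x), I 0,
      (forall x y, I x -> I y -> I (x + y)) &
      (forall a x, L a -> I x -> I (a * x))].

Definition left_noetherian (L : R -> Prop) : Prop :=
  forall I, left_ideal_of L I -> fg_left L I.

Section Filt.
Variables (M : eqType) (add : M -> M -> M) (z : M) (le : M -> M -> Prop).

Definition is_filtration (F : M -> R -> Prop) : Prop :=
  [/\ (forall a, Ksubmodule (F a)),
      (forall a b, le a b -> forall x, F a x -> F b x),
      (forall a b x y, F a x -> F b y -> F (add a b) (x * y)),
      (forall x, exists a, F a x)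
    & F z 1].

(* F_{<a}(R) = union of F_b(R) for b < a (the zero submodule if empty) *)
Definition Fprec (F : M -> R -> Prop) (a : M) (x : R) : Prop :=
  x = 0 \/ exists b, strict le b a /\ F b x.

(* ---------- the associated graded algebra G^F(R) ----------
   An element of G^F(R) = (+)_a F_a/F_{<a} is represented by a finite list
   of pairs (a, x) with x in F_a, standing for the sum of the classes
   [x]_a in F_a/F_{<a}.  Addition is concatenation, multiplication is
   [x]_a [y]_b = [x y]_(a+b) extended bilinearly, and two representatives
   are equal in G^F(R) when their components agree in every F_a/F_{<a}. *)
Definition gelt := seq (M * R).
Definition gwf (F : M -> R -> Prop) (g : gelt) : Prop :=
  forall p, p \in g -> F p.1 p.2.
Definition gcomp (g : gelt) (a : M) : R := \sum_(p <- g | p.1 == a) p.2.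
Definition geqv (F : M -> R -> Prop) (g h : gelt) : Prop :=
  forall a, Fprec F a (gcomp g a - gcomp h a).
Definition gadd (g h : gelt) : gelt := g ++ h.
Definition gmul (g h : gelt) : gelt :=
  [seq (add p.1 q.1, p.2 * q.2) | p <- g, q <- h].
Definition gzero : gelt := [::].
Definition gone : gelt := [:: (z, 1)].
(* an element of Lambda = F_z(R) = G_z, viewed in G^F(R) *)
Definition gdeg0 (l : R) : gelt := [:: (z, l)].
Definition gexp (g : gelt) (k : nat) : gelt := iter k (gmul g) gone.

Section Ore.
Variables (F : M -> R -> Prop) (L : R -> Prop) (s : nat) (y : 'I_s -> gelt).

Definition ymon (al : Nn s) : gelt :=
  foldr (fun i acc => gmul (gexp (y i) (al i)) acc) gone (enum 'I_s).
Definition ylin (S : seq (Nn s)) (c : Nn s -> R) : gelt :=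
  flatten [seq gmul (gdeg0 (c al)) (ymon al) | al <- S].
(* g lies in L[y_1;s_1]...[y_j;s_j], i.e. in the left L-span of the
   monomials in the first j variables (0-based indices < j) *)
Definition inB (j : nat) (g : gelt) : Prop :=
  exists (S : seq (Nn s)) (c : Nn s -> R),
    [/\ (forall al, L (c al)),
        (forall al, al \in S -> forall i : 'I_s, (j <= i)%N -> al i = 0%N)
      & geqv F g (ylin S c)].
End Ore.

(* G^F(R) = L[y_1;s_1]...[y_s;s_s] is a graded iterated Ore extension
   (without derivations) for some homogeneous y_1..y_s with
   s_j(y_i) = q_ji y_i for i < j.  Indices are 0-based. *)
Definition graded_iterated_ore (F : M -> R -> Prop) (L : R -> Prop) (s : nat)
  (q : 'I_s -> 'I_s -> R) : Prop :=
  exists (d : 'I_s -> M) (x : 'I_s -> R),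
    let y := fun i => [:: (d i, x i)] in
    [/\
        (forall i, F (d i) (x i)),
        (forall g, gwf F g -> exists (S : seq (Nn s)) (c : Nn s -> R),
             (forall al, L (c al)) /\ geqv F g (ylin y S c)),
        (forall (S : seq (Nn s)) (c : Nn s -> R), uniq S ->
             (forall al, L (c al)) -> geqv F (ylin y S c) gzero ->
             forall al, al \in S -> c al = 0)
      & exists sigma : 'I_s -> gelt -> gelt, forall j : 'I_s,
        let B := fun g => gwf F g /\ inB F L y j g in
        (forall g, B g -> B (sigma j g)) /\
        (forall g h, B g -> B h -> geqv F g h ->
                     geqv F (sigma j g) (sigma j h)) /\
        (forall g h, B g -> B h ->
            geqv F (sigma j (gadd g h)) (gadd (sigma j g) (sigma j h))) /\
        (forall g h, B g -> B h ->
            geqv F (sigma j (gmul g h)) (gmul (sigma j g) (sigma j h))) /\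
        geqv F (sigma j gone) gone /\
        (forall g, B g -> geqv F (gmul (y j) g) (gmul (sigma j g) (y j))) /\
        (forall i : 'I_s, (i < j)%N ->
            geqv F (sigma j (y i)) (gmul (gdeg0 (q j i)) (y i)))].
End Filt.

Definition xmon (s : nat) (x : 'I_s -> R) (al : Nn s) : R :=
  \prod_(i < s) x i ^+ al i.
End Alg.

(* Main.v *)
Require Import Defs.
From HB Require Import structures.
From mathcomp Require Import all_boot all_order all_algebra.
From mathcomp Require Import zify lra boolp.
Set Implicit Arguments. Unset Strict Implicit. Unset Printing Implicit Defensive.
Import Order.TTheory GRing.Theory Num.Theory.
Local Open Scope ring_scope.

(** From (i) or (ii) to (iii): lift each [y_i] to some [x_i] in [F_{d_i}]. Admissible
    orders are well-founded (Dickson), so induction on leading terms turns the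
    [L]-basis [y^al] of the graded algebra into the [L]-basis [x^al] of [R]; the
    degree, refined by the lexicographic order, is the required order on [N^s].
    The exponents occurring in the lower terms of [x_k a] are bounded uniformly in
    [a] because [F_{d_k}] is finitely generated.

    From (iii) back to (i) and (ii): finitely many strict comparisons in an
    admissible order are realized by positive integer weights [w]. The left
    [L]-spans of the monomials of weight at most [n] then form a filtration,
    and [sigma_j] exists because every element of [L[y_1]...[y_{j-1}]] can be
    moved across [y_j], uniquely since right multiplication by [y_j] is injective
    there. *)

(** Conditions (i) and (ii) differ only in the monoid of degrees, so both directions run over an
    abstract commutative monoid [M]: a cancellative one with a well-founded order on the way to
    (iii), and a copy of [nat] on the way back, which yields (i) with [n = 1]. The order in (iii)
    cannot itself index the new filtration: its initial segments may be infinite, so the steps would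
    not be finitely generated. Positive weights have finite sublevel sets and respect the finitely
    many comparisons that occur in the relations. On the way back, the hard point is that moving
    [x_k] past a coefficient or past another [x_i] creates lower terms that involve any of the
    variables. So multiplicativity of the filtration, and closure of the first [j] variables modulo
    lower weight, are proved in one induction. Elements of the graded algebra are lists of
    representatives; each identity there is reduced to congruences in [R], one for each degree. *)

Lemma Nn_addA n : associative (@Nn_add n).
Proof. by move=> a b c; apply/ffunP=> i; rewrite !ffunE addnA. Qed.

Lemma Nn_addC n : commutative (@Nn_add n).
Proof. by move=> a b; apply/ffunP=> i; rewrite !ffunE addnC. Qed.

Lemma Nn_add0 n : left_id (Nn_zero n) (@Nn_add n).
Proof. by move=> a; apply/ffunP=> i; rewrite !ffunE. Qed.

HB.instance Definition _ n := Monoid.isComLaw.Build (Nn n) (Nn_zero n)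
  (@Nn_add n) (@Nn_addA n) (@Nn_addC n) (@Nn_add0 n).

Lemma Nn_addI n : right_injective (@Nn_add n).
Proof.
move=> c a b /ffunP E; apply/ffunP=> i; move: (E i); rewrite !ffunE.
exact: addnI.
Qed.

(** * Admissible orders on a commutative monoid *)

Section AdmissibleOrder.
Variables (M : eqType) (z : M) (add : Monoid.com_law z) (le : M -> M -> Prop).
Hypotheses (adm : admissible add z le) (addI : right_injective add).

Lemma adm_refl a : le a a. Proof. by case: adm. Qed.

Lemma adm_anti a b : le a b -> le b a -> a = b.
Proof. by case: adm => _ [+ _]; exact. Qed.

Lemma adm_trans a b c : le a b -> le b c -> le a c.
Proof. by case: adm => _ [_ [+ _]]; exact. Qed.

Lemma adm_total a b : le a b \/ le b a.
Proof. by case: adm => _ [_ [_ [+ _]]]; exact. Qed.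

Lemma adm_addr a b c : le a b -> le (add a c) (add b c).
Proof. by case: adm => _ [_ [_ [_ [+ _]]]]; exact. Qed.

Lemma adm_ge0 a : le z a.
Proof. by case: adm => _ [_ [_ [_ [_ +]]]]; exact. Qed.

Lemma strict_le_trans a b c : strict le a b -> le b c -> strict le a c.
Proof.
move=> [ab ne] bc; split; first exact: adm_trans bc.
by move=> ac; apply: ne; apply: adm_anti => //; rewrite ac.
Qed.

Lemma le_strict_trans a b c : le a b -> strict le b c -> strict le a c.
Proof.
move=> ab [bc ne]; split; first exact: adm_trans bc.
by move=> ac; apply: ne; apply: adm_anti => //; rewrite -ac.
Qed.

(** Admissibility only asks for weak compatibility with addition; cancellation in [M] makes it
    strict. *)
Lemma strict_addr a b c : strict le a b -> strict le (add a c) (add b c).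
Proof.
move=> [ab ne]; split; first exact: adm_addr.
by rewrite ![add _ c]Monoid.mulmC => /addI.
Qed.

Lemma strict_addl a b c : strict le a b -> strict le (add c a) (add c b).
Proof. by rewrite ![add c _]Monoid.mulmC; exact: strict_addr. Qed.

Lemma adm_seq_max (T : eqType) (f : T -> M) (S : seq T) :
  S <> [::] -> exists2 b, b \in S & forall a, a \in S -> le (f a) (f b).
Proof.
elim: S => [//|a S IH] _.
have [->|/eqP /IH [b bS bmax]] := eqVneq S [::].
  by exists a; rewrite ?mem_head// => b; rewrite inE => /eqP ->; exact: adm_refl.
have [ab|ba] := adm_total (f a) (f b).
  by exists b; rewrite ?inE ?bS ?orbT// => c; rewrite inE => /predU1P[->|/bmax].
exists a; rewrite ?mem_head// => c; rewrite inE => /predU1P[->|/bmax cb].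
  exact: adm_refl.
exact: adm_trans ba.
Qed.

End AdmissibleOrder.

(** * Dickson's lemma, well-foundedness and the lexicographic order *)

(** Each index of the subsequence is a place where [g] attains its minimum over a tail, and the next
    tail starts just after it. *)
Lemma monotone_subsequence (g : nat -> nat) : exists phi : nat -> nat,
  {homo phi : i j / (i < j)%N} /\ {homo (g \o phi) : i j / (i <= j)%N}.
Proof.
have tail_min N : exists m, (N <= m)%N /\ forall k, (m <= k)%N -> (g m <= g k)%N.
  pose P v := `[< exists2 m, (N <= m)%N & g m = v >].
  have exP : exists v, P v by exists (g N); apply/asboolP; exists N.
  case: (ex_minnP exP) => v /asboolP[m Nm <-] vmin.
  exists m; split=> // k mk; apply: vmin; apply/asboolP.
  by exists k => //; exact: leq_trans mk.
have [h hP] := choice tail_min.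
pose phi i := iter i (fun m => h m.+1) (h 0%N).
exists phi; split.
  apply: homo_ltn => [? ? ?|i]; first exact: ltn_trans.
  by have [] := hP (phi i).+1.
apply: homo_leq => [?|? ? ?|i]; [exact: leqnn | exact: leq_trans |].
have gmin : forall k, (phi i <= k)%N -> (g (phi i) <= g k)%N.
  by case: i => [|i]; [have [] := hP 0%N | have [] := hP (phi i).+1].
by apply: gmin; have [/ltnW] := hP (phi i).+1.
Qed.

Lemma dickson n (f : nat -> Nn n) :
  exists i j : nat, (i < j)%N /\ forall l, (f i l <= f j l)%N.
Proof.
(* Successive refinement makes the first [k] coordinates nondecreasing; for [k = n] the first two
   terms of the subsequence are the required pair. *)
suff sub k : exists phi : nat -> nat, {homo phi : i j / (i < j)%N} /\
    forall l : 'I_n, (l < k)%N -> {homo (fun i => f (phi i) l) : i j / (i <= j)%N}.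
  have [phi [phiS mono]] := sub n; exists (phi 0%N), (phi 1%N); split.
    exact: phiS.
  by move=> l; exact: (mono l _ 0%N 1%N).
elim: k => [|k [phi [phiS mono]]]; first by exists id; split=> [i j|l]; rewrite ?ltn0.
have [kn|nk] := ltnP k n; last first.
  by exists phi; split=> // l _; apply: mono; exact: leq_trans nk.
have [psi [psiS psim]] := monotone_subsequence (fun i => f (phi i) (Ordinal kn)).
exists (phi \o psi); split=> [i j ij|l]; first exact/phiS/psiS.
rewrite ltnS leq_eqVlt => /orP[/eqP lk i j ij|lk i j ij].
  by have -> : l = Ordinal kn; [exact: val_inj | exact: psim].
by apply: mono => //; exact: (ltnW_homo psiS).
Qed.

(** An admissible order extends the componentwise order because zero is least, so a Dickson pair
    contradicts an infinite descent. *)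
Lemma admissible_wf n (le : Nn n -> Nn n -> Prop) :
  admissible (@Nn_add n) (Nn_zero n) le -> well_founded (strict le).
Proof.
move=> adm a; apply: contrapT => naccA.
have step b : exists c, ~ Acc (strict le) b -> strict le c b /\ ~ Acc (strict le) c.
  have [accb|naccb] := EM (Acc (strict le) b); first by exists b.
  apply: contrapT => H; apply: naccb; constructor=> c cb.
  by apply: contrapT => nc; apply: H; exists c.
have [p pP] := choice step.
pose f i := iter i p a.
have nacc i : ~ Acc (strict le) (f i) by elim: i => //= i /pP[].
have desc i j : (i < j)%N -> strict le (f j) (f i).
  elim: j => [//|j IH]; rewrite ltnS leq_eqVlt => /predU1P[->|/IH ji].
    by have [] := pP _ (nacc j).
  have [sj _] := pP _ (nacc j).
  by apply: (le_strict_trans adm) ji; case: sj.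
have [i [j [ij fij]]] := dickson f.
have [ji ne] := desc _ _ ij; apply: ne; apply: (adm_anti adm) => //.
have -> : f j = Nn_add [ffun l => (f j l - f i l)%N] (f i).
  by apply/ffunP=> l; rewrite !ffunE subnK.
rewrite -{1}[f i](@Nn_add0 n); apply: (adm_addr adm); exact: (adm_ge0 adm).
Qed.

Definition lexle n (a b : Nn n) : Prop :=
  a = b \/ exists i : 'I_n, (a i < b i)%N /\ forall k : 'I_n, (k < i)%N -> a k = b k.

Lemma lexle_admissible n : admissible (@Nn_add n) (Nn_zero n) (@lexle n).
Proof.
have total (a b : Nn n) : lexle a b \/ lexle b a.
  have [->|ne] := eqVneq a b; first by left; left.
  have [i0 ni0] : exists i, a i != b i.
    by apply/existsP; apply: contraNT ne => /existsPn E; apply/eqP/ffunP => i;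
       apply/eqP; rewrite -[_ == _]negbK E.
  case: (@arg_minnP _ i0 (fun i => a i != b i) (fun i => val i) ni0) => i ni imin.
  have eqk (k : 'I_n) : (k < i)%N -> a k = b k.
    by move=> ki; apply/eqP; apply: contraLR ki => /imin; rewrite -leqNgt.
  case: (ltngtP (a i) (b i)) ni => // lt _; [left|right]; right; exists i => //.
  by split=> // k /eqk.
split; [by left | split; [|split; [|split; [exact: total|split]]]].
- move=> a b [//|[i [lt eqi]]] [//|[j [lt' eqj]]].
  case: (ltngtP i j) => ij.
  + by move: (eqj _ ij) lt => ->; rewrite ltnn.
  + by move: (eqi _ ij) lt' => ->; rewrite ltnn.
  + by move: lt lt'; rewrite (val_inj ij) => h /(ltn_trans h); rewrite ltnn.
- move=> a b c [->//|[i [lt eqi]]] [<-|[j [lt' eqj]]]; first by right; exists i.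
  right; case: (ltngtP i j) => ij.
  + exists i; split=> [|k ki]; first by rewrite -eqj.
    by rewrite eqi// eqj//; exact: ltn_trans ij.
  + exists j; split=> [|k kj]; first by rewrite eqi.
    by rewrite eqi ?eqj//; exact: ltn_trans ij.
  + exists j; move: (val_inj ij) lt eqi => -> lt eqi.
    by split=> [|k kj]; [exact: ltn_trans lt' | rewrite eqi ?eqj].
- move=> a b c [->|[i [lt eqi]]]; first by left.
  right; exists i; split=> [|k ki]; rewrite !ffunE ?ltn_add2r//.
  by rewrite eqi.
- move=> a; have [//|[<-|[i [lt _]]]] := total (Nn_zero n) a; first by left.
  by move: lt; rewrite ffunE ltn0.
Qed.

(** * Integer weights realizing finitely many strict comparisons *)

(** This is the one-variable system that an elimination step leaves: [A] collects lower bounds, [B]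
    upper bounds, and either may be empty. *)
Lemma seq_separation (A B : seq rat) :
  (forall a b, a \in A -> b \in B -> a < b) ->
  exists t, (forall a, a \in A -> a < t) /\ (forall b, b \in B -> t < b).
Proof.
have lower (a : rat) (B' : seq rat) : (forall b, b \in B' -> a < b) ->
    exists2 t, a < t & forall b, b \in B' -> t < b.
  elim: B' => [_|b B' IH H]; first by exists (a + 1) => //; lra.
  have [|t at_ tB] := IH; first by move=> c cB; apply: H; rewrite inE cB orbT.
  have ab : a < b by apply: H; exact: mem_head.
  exists (Num.min t ((a + b) / 2)); first by rewrite lt_min at_; lra.
  move=> c; rewrite inE gt_min => /predU1P[->|/tB ->//].
  by apply/orP; right; lra.
elim: A => [_|a A IH H].
  elim: B => [|b B [t [_ tB]]]; first by exists 0.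
  exists (Num.min t (b - 1)); split=> // c; rewrite inE gt_min => /predU1P[->|/tB ->//].
  by apply/orP; right; lra.
have [|t [tA tB]] := IH.
  by move=> c b cA bB; apply: H; rewrite // inE cA orbT.
have [at_|ta] := ltP a t.
  by exists t; split=> // c; rewrite inE => /predU1P[->|/tA].
have [|u au uB] := lower a B; first by move=> b bB; apply: H => //; exact: mem_head.
exists u; split=> // c; rewrite inE => /predU1P[->//|/tA ct].
by apply: lt_trans ct _; exact: le_lt_trans au.
Qed.

(* Fourier-Motzkin elimination: the combinations that eliminate a coordinate
   stay in the semigroup [C], so no certificate needs to be tracked. *)
Lemma cone_weights s (C : 'rV[int]_s -> Prop) :
  (forall u v, C u -> C v -> C (u + v)) -> ~ C 0 ->
  forall k (V : seq 'rV[int]_s),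
    (forall v, v \in V -> C v /\ forall i : 'I_s, (k <= i)%N -> v 0 i = 0) ->
  exists w : 'I_s -> rat, forall v, v \in V -> 0 < \sum_i w i * (v 0 i)%:~R.
Proof.
move=> CD C0; have CM v m : C v -> C (v *+ m.+1).
  by move=> Cv; elim: m => [//|m IH]; rewrite mulrS; exact: CD.
elim=> [|k IH] V HV.
  (* A vector without nonzero coordinates is [0], which [C] excludes; hence [V] is empty here. *)
  exists (fun _ => 0) => v /HV[Cv v0]; case: C0; congr C: Cv.
  by apply/rowP=> i; rewrite v0// mxE.
have [ks|sk] := ltnP k s; last first.
  by apply: IH => v /HV[Cv v0]; split=> // i ki; apply: v0; have := ltn_ord i; lia.
pose o := Ordinal ks.
pose Vp := [seq v : 'rV[int]_s <- V | 0 < v 0 o].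
pose Vn := [seq v : 'rV[int]_s <- V | v 0 o < 0].
(* The multipliers are chosen so that coordinate [o] cancels when [v] is positive and [u] negative
   there; both are then positive, so [C] is preserved. *)
pose mix (v u : 'rV[int]_s) : 'rV[int]_s := u *+ absz (v 0 o) + v *+ absz (u 0 o).
have mixE v u i : mix v u 0 i = u 0 i *+ absz (v 0 o) + v 0 i *+ absz (u 0 o).
  by rewrite !mxE !mulmxnE.
have mix0 (v u : 'rV[int]_s) : 0 < v 0 o -> u 0 o < 0 -> mix v u 0 o = 0.
  by rewrite mixE; lia.
have [|w wP] := IH ([seq v : 'rV[int]_s <- V | v 0 o == 0] ++ [seq mix v u | v <- Vp, u <- Vn]).
  move=> v; rewrite mem_cat mem_filter => /orP[/andP[/eqP vo /HV[Cv v0]]|].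
    split=> // i; rewrite leq_eqVlt => /predU1P[ki|]; last exact: v0.
    by have <- : o = i by exact: val_inj.
  case/allpairsP=> -[a b] /= [+ + ->]; rewrite !mem_filter.
  move=> /andP[a_gt0 /HV[Ca a0]] /andP[b_lt0 /HV[Cb b0]]; split.
    apply: CD.
      case E: (absz (a 0 o)) => [|m]; last exact: CM.
      by move/eqP: E; rewrite absz_eq0 gt_eqF.
    case E: (absz (b 0 o)) => [|m]; last exact: CM.
    by move/eqP: E; rewrite absz_eq0 lt_eqF.
  move=> i; rewrite leq_eqVlt => /predU1P[ki|ki].
    by have <- : o = i; [exact: val_inj | exact: mix0].
  by rewrite mixE (a0 i ki) (b0 i ki) !mul0rn addr0.
pose D (v : 'rV[int]_s) := \sum_(i | i != o) w i * (v 0 i)%:~R.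
have dotE (v : 'rV[int]_s) (t : rat) : \sum_i (if i == o then t else w i) * (v 0 i)%:~R =
    t * (v 0 o)%:~R + D v.
  rewrite (bigD1 o)//= eqxx; congr (_ + _); apply: eq_bigr => i /negPf -> //.
have dotwE (v : 'rV[int]_s) : \sum_i w i * (v 0 i)%:~R = w o * (v 0 o)%:~R + D v.
  by rewrite (bigD1 o).
have Dmix v u : D (mix v u) = D u *+ absz (v 0 o) + D v *+ absz (u 0 o).
  rewrite /D -!sumrMnl -big_split/=; apply: eq_bigr => i _.
  by rewrite mixE intrD !rmorphMn/= mulrDr !mulrnAr.
(* With the other weights fixed, vectors of [Vp] bound the weight at [o] from below and those of
   [Vn] from above. Positivity on [mix v u] says exactly that every lower bound is less than every
   upper bound. *)
have [|t [tp tn]] := @seq_separation [seq - D v / (v 0 o)%:~R | v : 'rV[int]_s <- Vp]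
    [seq D u / - (u 0 o)%:~R | u : 'rV[int]_s <- Vn].
  move=> _ _ /mapP[v vV ->] /mapP[u uV ->].
  have := wP (mix v u); rewrite mem_cat allpairs_f// orbT => /(_ isT).
  move: vV uV; rewrite !mem_filter dotwE Dmix => /andP[vp _] /andP[un _].
  rewrite mix0// mulr0 add0r -(mulr_natr (D u)) -(mulr_natr (D v)) !natr_absz.
  rewrite gtr0_norm// ltr0_norm// => H.
  rewrite ltr_pdivrMr ?ltr0z// mulrAC ltr_pdivlMr ?oppr_gt0 ?ltrz0//.
  by move: H; rewrite rmorphN/=; lra.
exists (fun i => if i == o then t else w i) => v vV; rewrite dotE.
case: (ltgtP (v 0 o) 0) => vo.
- have vVn : v \in Vn by rewrite mem_filter vo.
  have := tn _ (map_f _ vVn).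
  by rewrite ltr_pdivlMr ?oppr_gt0 ?ltrz0//; lra.
- have vVp : v \in Vp by rewrite mem_filter vo.
  have := tp _ (map_f _ vVp).
  by rewrite ltr_pdivrMr ?ltr0z//; lra.
- have := wP v; rewrite mem_cat mem_filter vo eqxx vV => /(_ isT).
  by rewrite dotwE vo !mulr0.
Qed.

Definition wt s (w : 'I_s -> nat) (a : Nn s) : nat := (\sum_i w i * a i)%N.

(** The semigroup fed to [cone_weights] consists of the differences of all strict pairs: strict
    comparisons can be added, and no strict pair has difference zero. *)
Lemma admissible_weights s (le : Nn s -> Nn s -> Prop) (V : seq (Nn s * Nn s)) :
  admissible (@Nn_add s) (Nn_zero s) le ->
  (forall p, p \in V -> strict le p.1 p.2) ->
  exists w : 'I_s -> nat, (forall i, (0 < w i)%N) /\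
    forall p, p \in V -> (wt w p.1 < wt w p.2)%N.
Proof.
move=> adm HV.
pose vec (p : Nn s * Nn s) : 'rV[int]_s := \row_i ((p.2 i)%:Z - (p.1 i)%:Z).
pose C v := exists2 p, strict le p.1 p.2 & v = vec p.
(* The comparisons of zero with each [Nn_eps i] are included to force positive weights. *)
pose E := [seq (Nn_zero s, Nn_eps i) | i <- enum 'I_s].
have HVE p : p \in V ++ E -> strict le p.1 p.2.
  rewrite mem_cat => /orP[/HV//|/mapP[i _ ->]]; split=> /=.
    exact: (adm_ge0 adm).
  by move=> /ffunP/(_ i); rewrite !ffunE eqxx.
have [|||w wP] := @cone_weights s C _ _ s (map vec (V ++ E)).
- move=> _ _ [p [lep nep] ->] [p' [lep' nep'] ->].
  exists (Nn_add p.1 p'.1, Nn_add p.2 p'.2) => /=.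
    apply: (@strict_le_trans _ _ _ _ adm _ (Nn_add p.2 p'.1)).
      exact: (strict_addr adm (@Nn_addI s)).
    by rewrite ![Nn_add p.2 _]Nn_addC; exact: (adm_addr adm).
  by apply/rowP=> i; rewrite !mxE !ffunE !PoszD; lia.
- case=> p [_ nep] /rowP E0; apply: nep; apply/ffunP => i.
  by have := E0 i; rewrite !mxE => /eqP; rewrite eq_sym subr_eq0 => /eqP[->].
- move=> _ /mapP[p /HVE Hp ->]; split; first by exists p.
  by move=> i; rewrite leqNgt ltn_ord.
(* A common denominator: scaling by it makes the rational weights integral and keeps all signs. *)
pose N := \prod_i denq (w i).
have N_gt0 : 0 < N by apply: prodr_gt0 => i _; exact: denq_gt0.
have wN i : exists m : int, N%:~R * w i = m%:~R.
  exists (numq (w i) * \prod_(j | j != i) denq (w j)).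
  rewrite /N (bigD1 i)//= !intrM mulrAC; congr (_ * _).
  by rewrite mulrC numqE.
have [m mP] := choice wN.
have mpos p : p \in V ++ E -> 0 < \sum_i m i * ((p.2 i)%:Z - (p.1 i)%:Z).
  move=> pV; have := wP _ (map_f vec pV).
  rewrite -(pmulr_rgt0 _ (_ : 0 < (N%:~R : rat))) ?ltr0z// mulr_sumr.
  rewrite (eq_bigr (fun i => (m i * ((p.2 i)%:Z - (p.1 i)%:Z))%:~R)) => [|i _].
    by rewrite -(rmorph_sum (intmul 1)) ltr0z.
  by rewrite mulrA mP mxE intrM.
have m_gt0 i : 0 < m i.
  have := mpos (Nn_zero s, Nn_eps i); rewrite mem_cat map_f ?mem_enum ?orbT//.
  move=> /(_ isT); rewrite (bigD1 i)//= big1 ?addr0 => [|j ji].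
    by rewrite !ffunE eqxx subr0 mulr1.
  by rewrite !ffunE (negPf ji) subrr mulr0.
exists (fun i => `|m i|%N); split=> [i|p pV]; first by rewrite absz_gt0 gt_eqF.
have wtE (a : Nn s) : (wt (fun i => `|m i|%N) a)%:Z = \sum_i m i * (a i)%:Z.
  rewrite /wt (big_morph Posz PoszD (erefl 0%:Z)); apply: eq_bigr => i _.
  by rewrite PoszM gtz0_abs.
have := mpos p; rewrite mem_cat pV => /(_ isT); under eq_bigr do rewrite mulrBr.
by rewrite sumrB -!wtE subr_gt0 ltz_nat.
Qed.


(** * Left spans of standard monomials and coefficients in a monomial basis *)

Section SubmoduleClosure.
Variables (K : comPzRingType) (R : algType K).

Lemma KsubmoduleN (P : R -> Prop) r : Ksubmodule P -> P r -> P (- r).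
Proof. by case=> _ _ PZ; rewrite -scaleN1r; exact: PZ. Qed.

Lemma KsubmoduleB (P : R -> Prop) r t : Ksubmodule P -> P r -> P t -> P (r - t).
Proof. by move=> hP Pr Pt; case: (hP) => _ PD _; apply: PD => //; exact: KsubmoduleN. Qed.

Lemma Ksubmodule_sum (P : R -> Prop) (I : eqType) (S : seq I) (p : pred I) (f : I -> R) :
  Ksubmodule P -> (forall i, i \in S -> p i -> P (f i)) ->
  P (\sum_(i <- S | p i) f i).
Proof.
case=> P0 PD _ Pf; rewrite big_seq_cond.
by apply: big_ind => // i /andP[]; exact: Pf.
Qed.

End SubmoduleClosure.

Section MonomialSpan.
Variables (K : comPzRingType) (R : algType K) (L : R -> Prop).
Hypothesis hL : subalgebra L.
Variables (s : nat) (x : 'I_s -> R).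

Let LK : Ksubmodule L. Proof. by case: hL. Qed.
Let L1 : L 1. Proof. by case: hL. Qed.
Let LM a b : L a -> L b -> L (a * b). Proof. by case: hL => _ _; exact. Qed.
Let L0 : L 0. Proof. by case: LK. Qed.
Let LD a b : L a -> L b -> L (a + b). Proof. by case: LK => _ + _; exact. Qed.

(** The left [L]-span of the monomials with exponent in [T], built term by term so that membership
    can be used by induction on summands. Repeated exponents are allowed; [mspan_expand] merges
    them. *)
Inductive mspan (T : Nn s -> Prop) : R -> Prop :=
| mspan0 : mspan T 0
| mspan_cons c a r : L c -> T a -> mspan T r -> mspan T (c * xmon x a + r).

Lemma mspan_mono (T T' : Nn s -> Prop) r :
  (forall a, T a -> T' a) -> mspan T r -> mspan T' r.
Proof.
move=> TT'; elim=> [|c a t Lc Ta _ IH]; first exact: mspan0.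
by apply: mspan_cons => //; exact: TT'.
Qed.

Lemma mspanD T r t : mspan T r -> mspan T t -> mspan T (r + t).
Proof.
move=> + spt; elim=> [|c a u Lc Ta _ IH]; first by rewrite add0r.
by rewrite -addrA; exact: mspan_cons.
Qed.

Lemma mspanMl T c r : L c -> mspan T r -> mspan T (c * r).
Proof.
move=> Lc; elim=> [|d a t Ld Ta _ IH]; first by rewrite mulr0; exact: mspan0.
by rewrite mulrDr mulrA; apply: mspan_cons => //; exact: LM.
Qed.

Lemma mspan_mon T c a : L c -> T a -> mspan T (c * xmon x a).
Proof. by move=> Lc Ta; rewrite -[_ * _]addr0; apply: mspan_cons => //; exact: mspan0. Qed.

Lemma mspan_Ksubmodule T : Ksubmodule (mspan T).
Proof.
split; [exact: mspan0 | exact: mspanD | move=> k r].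
elim=> [|c a t Lc Ta _ IH]; first by rewrite scaler0; exact: mspan0.
rewrite scalerDr scalerAl; apply: mspan_cons => //.
by case: LK => _ _; exact.
Qed.

Lemma mspanB T r t : mspan T r -> mspan T t -> mspan T (r - t).
Proof. by apply: KsubmoduleB; exact: mspan_Ksubmodule. Qed.

Lemma mspan_sum (T : Nn s -> Prop) (S : seq (Nn s)) (p : pred (Nn s)) (c : Nn s -> R) :
  (forall a, L (c a)) -> (forall a, a \in S -> p a -> T a) ->
  mspan T (\sum_(a <- S | p a) c a * xmon x a).
Proof.
move=> Lc ST; apply: Ksubmodule_sum; first exact: mspan_Ksubmodule.
by move=> a aS pa; apply: mspan_mon => //; exact: ST.
Qed.

Lemma mspan_expand T r : mspan T r -> exists (S : seq (Nn s)) (c : Nn s -> R),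
  [/\ uniq S, forall a, L (c a), forall a, a \in S -> T a,
      forall a, a \notin S -> c a = 0 & r = \sum_(a <- S) c a * xmon x a].
Proof.
elim=> [|d a t Ld Ta _ [S [c [uS Lc ST cS ->]]]].
  by exists [::], (fun=> 0); split; rewrite ?big_nil.
pose S' := if a \in S then S else a :: S.
have memS' b : (b \in S') = (b == a) || (b \in S).
  by rewrite /S'; case: ifP => aS; rewrite ?inE//; case: eqP => // ->.
exists S', (fun b => c b + (if b == a then d else 0)); split.
- by rewrite /S'; case: ifP => //= ->.
- by move=> b; case: ifP => _; rewrite ?addr0//; exact: LD.
- by move=> b; rewrite memS' => /predU1P[->//|/ST].
- by move=> b; rewrite memS' negb_or => /andP[/negPf -> /cS ->]; rewrite addr0.
have uS' : uniq S' by rewrite /S'; case: ifP => //= ->.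
have aS' : a \in S' by rewrite memS' eqxx.
under [in RHS]eq_bigr do rewrite mulrDl.
rewrite big_split/= addrC; congr (_ + _).
  by rewrite (bigD1_seq a)//= eqxx big1 ?addr0// => b /negPf ->; rewrite mul0r.
by rewrite /S'; case: ifPn => // aS; rewrite big_cons cS// mul0r add0r.
Qed.

Lemma mspan_of_sum (S : seq (Nn s)) (c : Nn s -> R) :
  (forall a, L (c a)) -> mspan (fun=> True) (\sum_(a <- S) c a * xmon x a).
Proof. by move=> Lc; exact: mspan_sum. Qed.

Lemma sum_widen (Q U : seq (Nn s)) (e : Nn s -> R) :
  uniq Q -> uniq U -> {subset Q <= U} -> (forall a, a \notin Q -> e a = 0) ->
  \sum_(a <- U) e a * xmon x a = \sum_(a <- Q) e a * xmon x a.
Proof.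
move=> uQ uU QU eQ; rewrite (bigID (mem Q))/= [X in _ + X]big1 ?addr0; last first.
  by move=> a /eQ ->; rewrite mul0r.
rewrite -big_filter; apply: perm_big; apply: uniq_perm => //.
  exact: filter_uniq.
by move=> a; rewrite mem_filter andb_idr//; exact: QU.
Qed.

Definition mon_free := forall (S : seq (Nn s)) (c : Nn s -> R), uniq S ->
  (forall a, L (c a)) -> \sum_(a <- S) c a * xmon x a = 0 ->
  forall a, a \in S -> c a = 0.

Hypotheses (spanT : forall r, mspan (fun=> True) r) (free : mon_free).

Lemma mcoef_exists r : exists c : Nn s -> R, (forall a, L (c a)) /\
  exists S : seq (Nn s), [/\ uniq S, forall a, a \notin S -> c a = 0 &
    r = \sum_(a <- S) c a * xmon x a].
Proof.
have [S [c [uS Lc _ cS ->]]] := mspan_expand (spanT r).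
by exists c; split=> //; exists S.
Qed.

(** Chosen from the spanning property alone. Freeness enters with [mcoef_unique], which makes the
    choice canonical and hence additive and left [L]-linear. *)
Definition mcoef r : Nn s -> R := projT1 (cid (mcoef_exists r)).

Lemma mcoefL r a : L (mcoef r a).
Proof. by rewrite /mcoef; case: cid => c [Lc _] /=. Qed.

Lemma mcoef_expand r : exists S : seq (Nn s),
  [/\ uniq S, forall a, a \notin S -> mcoef r a = 0 &
    r = \sum_(a <- S) mcoef r a * xmon x a].
Proof. by rewrite /mcoef; case: cid => c []. Qed.

Lemma mcoef_unique (S : seq (Nn s)) (c : Nn s -> R) : uniq S -> (forall a, L (c a)) ->
  (forall a, a \notin S -> c a = 0) ->
  mcoef (\sum_(a <- S) c a * xmon x a) =1 c.
Proof.
move=> uS Lc cS b; set r := \sum_(a <- S) _.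
have [S' [uS' cS' rE]] := mcoef_expand r.
pose U := undup (b :: S ++ S').
have uU : uniq U by exact: undup_uniq.
have : \sum_(a <- U) (mcoef r a - c a) * xmon x a = 0.
  under eq_bigr do rewrite mulrBl.
  rewrite sumrB (@sum_widen S' U (mcoef r))//; last first.
    by move=> a aS; rewrite mem_undup inE mem_cat aS ?orbT.
  rewrite (@sum_widen S U c)//; last first.
    by move=> a aS; rewrite mem_undup inE mem_cat aS ?orbT.
  by rewrite -rE subrr.
move/free => /(_ (undup_uniq _) _ b) H.
apply/eqP; rewrite -subr_eq0; apply/eqP; apply: H.
  by move=> a; apply: KsubmoduleB => //; exact: mcoefL.
by rewrite mem_undup mem_head.
Qed.

Lemma mcoefP r c : (forall a, L (c a)) ->
  (exists S : seq (Nn s), [/\ uniq S, forall a, a \notin S -> c a = 0 &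
    r = \sum_(a <- S) c a * xmon x a]) -> mcoef r =1 c.
Proof. by move=> Lc [S [uS cS ->]]; exact: mcoef_unique. Qed.

(** By uniqueness of coefficients, membership in a span is a vanishing condition; this is how top
    and lower terms are told apart later. *)
Lemma mspanP T r : mspan T r <-> forall a, ~ T a -> mcoef r a = 0.
Proof.
split=> [/mspan_expand[S [c [uS Lc ST cS ->]]] a nTa|H].
  by rewrite mcoef_unique// cS//; apply/negP => /ST.
have [S [uS cS ->]] := mcoef_expand r.
rewrite (bigID (fun a => `[< T a >]))/= [X in _ + X]big1 ?addr0; last first.
  by move=> a /asboolPn/H ->; rewrite mul0r.
apply: mspan_sum; [exact: mcoefL | by move=> a _ /asboolP].
Qed.

Lemma mcoef_support_sum (S : seq (Nn s)) r : uniq S ->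
  (forall a, a \notin S -> mcoef r a = 0) ->
  r = \sum_(a <- S) mcoef r a * xmon x a.
Proof.
move=> uS cS; have [S' [uS' cS' rE]] := mcoef_expand r; rewrite {1}rE.
pose U := undup (S ++ S').
have uU : uniq U by exact: undup_uniq.
rewrite -(@sum_widen S' U)// ?(@sum_widen S U)// => a aS;
by rewrite mem_undup mem_cat aS ?orbT.
Qed.

Lemma mcoef_sum (S : seq (Nn s)) (p : pred (Nn s)) (c : Nn s -> R) a :
  uniq S -> (forall a, L (c a)) ->
  mcoef (\sum_(a <- S | p a) c a * xmon x a) a = if (a \in S) && p a then c a else 0.
Proof.
move=> uS Lc; rewrite -big_filter.
rewrite (eq_big_seq (fun b => (if (b \in S) && p b then c b else 0) * xmon x b)).
  apply: mcoef_unique; first exact: filter_uniq.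
    by move=> b; case: ifP.
  by move=> b; rewrite mem_filter andbC => /negPf ->.
by move=> b; rewrite mem_filter andbC => ->.
Qed.

Lemma mcoefD r t a : mcoef (r + t) a = mcoef r a + mcoef t a.
Proof.
have [S [uS cS rE]] := mcoef_expand r; have [S' [uS' cS' tE]] := mcoef_expand t.
pose U := undup (S ++ S').
have uU : uniq U by exact: undup_uniq.
have SU : {subset S <= U} by move=> b bS; rewrite mem_undup mem_cat bS.
have SU' : {subset S' <= U} by move=> b bS; rewrite mem_undup mem_cat bS orbT.
move: a; apply: mcoefP => [a|]; first by apply: LD; exact: mcoefL.
exists U; split; first exact: undup_uniq.
  move=> a aU; rewrite cS ?cS' ?addr0//; first by apply: contra aU; exact: SU'.
  by apply: contra aU; exact: SU.
under eq_bigr do rewrite mulrDl.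
by rewrite big_split/= (@sum_widen S U (mcoef r))// (@sum_widen S' U (mcoef t))// -rE -tE.
Qed.

Lemma mcoef0 a : mcoef 0 a = 0.
Proof. by apply: (addrI (mcoef 0 a)); rewrite -mcoefD !addr0. Qed.

Lemma mcoefB r t a : mcoef (r - t) a = mcoef r a - mcoef t a.
Proof. by apply/eqP; rewrite eq_sym subr_eq -mcoefD subrK. Qed.

Lemma mcoefMl c r a : L c -> mcoef (c * r) a = c * mcoef r a.
Proof.
move=> Lc; move: a; apply: mcoefP => [a|].
  by apply: LM => //; exact: mcoefL.
have [S [uS cS rE]] := mcoef_expand r; exists S; split=> //.
  by move=> a /cS ->; rewrite mulr0.
by rewrite {1}rE mulr_sumr; apply: eq_bigr => a _; rewrite mulrA.
Qed.

Lemma mcoef_bigsum n (f : 'I_n -> R) a : mcoef (\sum_k f k) a = \sum_k mcoef (f k) a.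
Proof.
rewrite (big_morph (mcoef^~ a) (id1 := 0) (op1 := +%R))// => [r t|].
  exact: mcoefD.
exact: mcoef0.
Qed.

End MonomialSpan.

(** * Computing with representatives in the associated graded algebra *)

Section GradedElements.
Variables (K : comPzRingType) (R : algType K).
Variables (M : eqType) (z : M) (add : Monoid.com_law z).
Implicit Types (g h : gelt R M) (a b c : M).

Lemma gcomp_cat g h a : gcomp (g ++ h) a = gcomp g a + gcomp h a.
Proof. by rewrite /gcomp big_cat. Qed.

Lemma gcomp1 b r a : gcomp [:: (b, r) : M * R] a = if b == a then r else 0.
Proof. by rewrite /gcomp big_mkcond big_seq1. Qed.

Lemma gmul_catl g g' h : gmul add (g ++ g') h = gmul add g h ++ gmul add g' h.
Proof. by rewrite /gmul allpairs_cat. Qed.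

Lemma gcomp_gmul g h c : gcomp (gmul add g h) c =
  \sum_(p <- g) \sum_(q <- h) if add p.1 q.1 == c then p.2 * q.2 else 0.
Proof. by rewrite /gcomp /gmul big_mkcond big_allpairs_dep. Qed.

Lemma gcomp_gmul_l g h c : gcomp (gmul add g h) c =
  \sum_(p <- g) p.2 * \sum_(q <- h | add p.1 q.1 == c) q.2.
Proof.
rewrite gcomp_gmul; apply: eq_bigr => p _; rewrite mulr_sumr [RHS]big_mkcond.
by apply: eq_bigr => q _; case: ifP.
Qed.

Lemma gcomp_gmul_r g h c : gcomp (gmul add g h) c =
  \sum_(q <- h) (\sum_(p <- g | add p.1 q.1 == c) p.2) * q.2.
Proof.
rewrite gcomp_gmul exchange_big; apply: eq_bigr => q _ /=.
rewrite mulr_suml [RHS]big_mkcond.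
by apply: eq_bigr => p _; case: ifP.
Qed.

(** The left factor is grouped by degree because membership in a subalgebra of the tower controls
    only whole components [gcomp g a], not the single entries of the list. *)
Lemma gcomp_gmul_partition g h c : gcomp (gmul add g h) c =
  \sum_(a <- undup (map fst g)) gcomp g a * \sum_(q <- h | add a q.1 == c) q.2.
Proof.
rewrite gcomp_gmul_l /gcomp.
transitivity (\sum_(p <- g) \sum_(a <- undup (map fst g))
    if p.1 == a then p.2 * \sum_(q <- h | add a q.1 == c) q.2 else 0).
  apply: eq_big_seq => p pg.
  rewrite (bigD1_seq p.1) ?undup_uniq ?mem_undup ?map_f//= eqxx [X in _ + X]big1 ?addr0//.
  by move=> a /negPf; rewrite eq_sym => ->.
rewrite exchange_big; apply: eq_bigr => a _ /=.
by rewrite mulr_suml [RHS]big_mkcond.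
Qed.

Lemma gcomp_notin g a : a \notin map fst g -> gcomp g a = 0.
Proof.
move=> ag; rewrite /gcomp big_seq_cond big1// => p /andP[pg /eqP pa].
by rewrite -pa map_f in ag.
Qed.

Lemma gcomp_gmulA g h k c :
  gcomp (gmul add (gmul add g h) k) c = gcomp (gmul add g (gmul add h k)) c.
Proof.
rewrite !gcomp_gmul /gmul big_allpairs_dep; apply: eq_bigr => p _.
rewrite big_allpairs_dep; apply: eq_bigr => q _; apply: eq_bigr => t _ /=.
by rewrite Monoid.mulmA mulrA.
Qed.

Lemma gcomp_gmul_catr g h h' c :
  gcomp (gmul add g (h ++ h')) c = gcomp (gmul add g h ++ gmul add g h') c.
Proof.
rewrite gcomp_cat !gcomp_gmul -big_split; apply: eq_bigr => p _.
by rewrite big_cat.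
Qed.

Section Monomials.
Variables (s : nat) (d : 'I_s -> M) (x : 'I_s -> R).
Implicit Types al be : Nn s.

(** The degree of the monomial with exponent [al] when variable [i] has degree [d i]; the multiples
    are iterated sums, as [M] is only a monoid. *)
Definition dg al : M := \big[add/z]_(i < s) iter (al i) (add (d i)) z.

Lemma dgD al be : dg (Nn_add al be) = add (dg al) (dg be).
Proof.
rewrite /dg -big_split; apply: eq_bigr => i _; rewrite ffunE /=.
elim: (al i) => [|k IH]; first by rewrite add0n /= Monoid.mul1m.
by rewrite addSn !iterS IH Monoid.mulmA.
Qed.

Lemma dg0 : dg (Nn_zero s) = z.
Proof. by rewrite /dg big1// => i _; rewrite ffunE. Qed.

Lemma dg_eps i : dg (Nn_eps i) = d i.
Proof.
rewrite /dg (bigD1 i)//= ffunE eqxx /= Monoid.mulm1 big1 ?Monoid.mulm1//.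
by move=> j /negPf ji; rewrite ffunE ji.
Qed.

Lemma xmon0 : xmon x (Nn_zero s) = 1.
Proof. by rewrite /xmon big1// => i _; rewrite ffunE. Qed.

Lemma xmon_eps i : xmon x (Nn_eps i) = x i.
Proof.
transitivity (\prod_(k < s) (if k == i then x k else 1)).
  by apply: eq_bigr => k _; rewrite ffunE; case: eqP.
by rewrite -big_mkcond big_pred1_eq.
Qed.

Lemma gexp1 (b : M) (r : R) k :
  gexp add z [:: (b, r)] k = [:: (iter k (add b) z, r ^+ k)].
Proof. by elim: k => [//|k]; rewrite /gexp iterS => -> /=; rewrite exprS. Qed.

(** Each [y i] is a single pair, so a monomial in the [y i] is literally the class of the same
    monomial in the lifts [x i]. This links bases of the graded algebra to bases of [R]. *)
Lemma ymonE al :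
  ymon add z (fun i => [:: (d i, x i)]) al = [:: (dg al, xmon x al)].
Proof.
rewrite /ymon /dg /xmon ![index_enum _]unlock -!enumT.
elim: (enum 'I_s) => [|i e IH]; first by rewrite !big_nil.
by rewrite !big_cons /= IH gexp1.
Qed.

Lemma gcomp_ylin (S : seq (Nn s)) (c : Nn s -> R) a :
  gcomp (ylin add z (fun i => [:: (d i, x i)]) S c) a =
  \sum_(al <- S | dg al == a) c al * xmon x al.
Proof.
rewrite /ylin; elim: S => [|al S IH]; first by rewrite /gcomp !big_nil.
rewrite map_cons [flatten _]/= gcomp_cat IH ymonE /= gcomp1 Monoid.mul1m.
by rewrite big_cons; case: ifP => // _; rewrite add0r.
Qed.

End Monomials.

Section Filtered.
Variables (le : M -> M -> Prop) (F : M -> R -> Prop).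
Hypotheses (adm : admissible add z le) (addI : right_injective add).
Hypothesis filt : is_filtration add z le F.

Lemma filt_Ksubmodule a : Ksubmodule (F a). Proof. by case: filt. Qed.

Lemma filt_mono a b r : le a b -> F a r -> F b r.
Proof. by case: filt => _ + _ _ _ ab; apply. Qed.

Lemma filtM a b r t : F a r -> F b t -> F (add a b) (r * t).
Proof. by case: filt => _ _ + _ _; exact. Qed.

Lemma Fprec_F a r : Fprec le F a r -> F a r.
Proof.
case=> [->|[b [[ba _]]]]; last exact: filt_mono.
by case: (filt_Ksubmodule a).
Qed.

Lemma Fprec_Ksubmodule a : Ksubmodule (Fprec le F a).
Proof.
split; [by left | | ].
- move=> r t [->|[b [ba Fr]]]; first by rewrite add0r.
  move=> [->|[b' [ba' Ft]]]; first by rewrite addr0; right; exists b.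
  right; have [bb'|b'b] := adm_total adm b b'.
    exists b'; split=> //; case: (filt_Ksubmodule b') => _ FD _.
    by apply: FD => //; exact: filt_mono Fr.
  exists b; split=> //; case: (filt_Ksubmodule b) => _ FD _.
  by apply: FD => //; exact: filt_mono Ft.
- move=> k r [->|[b [ba Fr]]]; first by rewrite scaler0; left.
  by right; exists b; split=> //; case: (filt_Ksubmodule b) => _ _; exact.
Qed.

Lemma Fprec_mull a b r t : F a r -> Fprec le F b t -> Fprec le F (add a b) (r * t).
Proof.
move=> Fr [->|[b' [bb' Ft]]]; first by rewrite mulr0; left.
right; exists (add a b'); split; last exact: filtM.
exact: (strict_addl adm addI).
Qed.

Lemma Fprec_mulr a b r t : Fprec le F a r -> F b t -> Fprec le F (add a b) (r * t).
Proof.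
move=> [->|[a' [aa' Fr]]] Ft; first by rewrite mul0r; left.
right; exists (add a' b); split; last exact: filtM.
exact: (strict_addr adm addI).
Qed.

Lemma F_dg_xmon s (d : 'I_s -> M) (x : 'I_s -> R) (al : Nn s) :
  (forall i, F (d i) (x i)) -> F (dg d al) (xmon x al).
Proof.
move=> Fx; rewrite /dg /xmon; apply: (big_ind2 F); first by case: filt.
  by move=> *; exact: filtM.
move=> i _; elim: (al i) => [|k IH]; first by case: filt.
by rewrite iterS exprS; exact: filtM.
Qed.

Lemma geqv_gcomp g h : gcomp g =1 gcomp h -> geqv le F g h.
Proof. by move=> E a; left; rewrite E subrr. Qed.

Lemma geqv_sym g h : geqv le F g h -> geqv le F h g.
Proof.
by move=> E a; rewrite -opprB; apply: KsubmoduleN => //; exact: Fprec_Ksubmodule.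
Qed.

Lemma geqv_trans h g k : geqv le F g h -> geqv le F h k -> geqv le F g k.
Proof.
move=> gh hk a; case: (Fprec_Ksubmodule a) => _ FD _.
by have := FD _ _ (gh a) (hk a); rewrite addrA subrK.
Qed.

Lemma geqv_cat g g' h h' : geqv le F g g' -> geqv le F h h' ->
  geqv le F (g ++ h) (g' ++ h').
Proof.
move=> gg hh a; rewrite !gcomp_cat opprD addrACA.
by case: (Fprec_Ksubmodule a) => _ + _; apply.
Qed.

Lemma gwf_cat g h : gwf F g -> gwf F h -> gwf F (g ++ h).
Proof. by move=> wg wh p; rewrite mem_cat => /orP[/wg|/wh]. Qed.

Lemma gwf1 a r : F a r -> gwf F [:: (a, r)].
Proof. by move=> Fr p; rewrite inE => /eqP ->. Qed.

Lemma gwf_gmul g h : gwf F g -> gwf F h -> gwf F (gmul add g h).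
Proof.
by move=> wg wh _ /allpairsP[[p q] /= [/wg Fp /wh Fq ->]]; exact: filtM.
Qed.

Lemma gwf_gcomp g a : gwf F g -> F a (gcomp g a).
Proof.
move=> wg; apply: Ksubmodule_sum; first exact: filt_Ksubmodule.
by move=> p /wg + /eqP <-.
Qed.

Lemma sum_shift_l h a b :
  \sum_(q <- h | add a q.1 == add a b) q.2 = gcomp h b.
Proof. by apply: eq_bigl => q; rewrite (inj_eq (@addI a)). Qed.

Lemma sum_shift_r g a b :
  \sum_(p <- g | add p.1 b == add a b) p.2 = gcomp g a.
Proof.
by apply: eq_bigl => p; rewrite ![add _ b]Monoid.mulmC (inj_eq (@addI b)).
Qed.

Lemma geqv_gmull g h h' : gwf F g -> geqv le F h h' ->
  geqv le F (gmul add g h) (gmul add g h').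
Proof.
move=> wg hh c; rewrite !gcomp_gmul_l -sumrB.
apply: Ksubmodule_sum; first exact: Fprec_Ksubmodule.
move=> p /wg Fp _; rewrite -mulrBr.
(* [M] has no subtraction: either [c] is a translate of some [b], which cancellation determines, or
   both inner sums are empty. *)
have [[b <-]|nb] := EM (exists b, add p.1 b = c).
  by rewrite !sum_shift_l; exact: Fprec_mull.
rewrite !big1 => [||q /eqP E]; first by left; rewrite subrr mulr0.
  by move=> q /eqP E; case: nb; exists q.1.
by case: nb; exists q.1.
Qed.

Lemma geqv_gmulr g g' h : gwf F h -> geqv le F g g' ->
  geqv le F (gmul add g h) (gmul add g' h).
Proof.
move=> wh gg c; rewrite !gcomp_gmul_r -sumrB.
apply: Ksubmodule_sum; first exact: Fprec_Ksubmodule.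
move=> q /wh Fq _; rewrite -mulrBl.
have [[b <-]|nb] := EM (exists b, add b q.1 = c).
  by rewrite !sum_shift_r; exact: Fprec_mulr.
rewrite !big1 => [||p /eqP E]; first by left; rewrite subrr mul0r.
  by move=> p /eqP E; case: nb; exists p.1.
by case: nb; exists p.1.
Qed.

Lemma gcomp_gmul1l b r g a : gcomp (gmul add [:: (b, r)] g) (add b a) = r * gcomp g a.
Proof. by rewrite gcomp_gmul_l big_seq1 sum_shift_l. Qed.

Lemma gcomp_gmul1r b r g a : gcomp (gmul add g [:: (b, r)]) (add a b) = gcomp g a * r.
Proof. by rewrite gcomp_gmul_r big_seq1 sum_shift_r. Qed.

(** Reduces a relation of the shape [y g = h y] to one congruence in [R] for each degree. In degrees
    that are not translates by [b], both sides have zero component. *)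
Lemma geqv_mul1P b r t g h :
  geqv le F (gmul add [:: (b, r)] g) (gmul add h [:: (b, t)]) <->
  forall a, Fprec le F (add a b) (r * gcomp g a - gcomp h a * t).
Proof.
split=> [E a|E c].
  by have := E (add a b); rewrite gcomp_gmul1r Monoid.mulmC gcomp_gmul1l.
have [[a <-]|na] := EM (exists a, add a b = c).
  by rewrite gcomp_gmul1r [in gcomp _ (add a b)]Monoid.mulmC gcomp_gmul1l.
left; rewrite gcomp_gmul_l gcomp_gmul_r !big_seq1.
rewrite !big1 ?mulr0 ?mul0r ?subrr// => p /eqP E'; case: na; exists p.1 => //.
by rewrite Monoid.mulmC.
Qed.

End Filtered.
End GradedElements.

(** Condition (iii) of the theorem, named so that both directions can refer to it. *)
Definition pbw_presentation (K : comPzRingType) (R : algType K) (L : R -> Prop)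
    (s : nat) (q : 'I_s -> 'I_s -> R) : Prop :=
  exists (x : 'I_s -> R) (le : Nn s -> Nn s -> Prop)
         (Gam2 : 'I_s -> 'I_s -> seq (Nn s)) (Gam1 : 'I_s -> seq (Nn s)),
    admissible (@Nn_add s) (Nn_zero s) le /\
    [/\ (forall i j, uniq (Gam2 j i)) /\ (forall k, uniq (Gam1 k)),
        (forall i j : 'I_s, (i < j)%N -> forall g, g \in Gam2 j i ->
           strict le g (Nn_add (Nn_eps i) (Nn_eps j))) /\
        (forall k g, g \in Gam1 k -> strict le g (Nn_eps k)),
        (forall r, exists (S : seq (Nn s)) (c : Nn s -> R),
           (forall al, L (c al)) /\ r = \sum_(al <- S) c al * xmon x al) /\
        mon_free L x,
        (forall i j : 'I_s, (i < j)%N -> exists c : Nn s -> R,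
           (forall al, L (c al)) /\
           x j * x i = q j i * x i * x j + \sum_(al <- Gam2 j i) c al * xmon x al)
      & (forall (a : R) (k : 'I_s), L a -> exists (ak : R) (c : Nn s -> R),
           [/\ L ak, (forall al, L (c al)) &
               x k * a = ak * x k + \sum_(al <- Gam1 k) c al * xmon x al])].

(** * From a graded iterated Ore extension to a basis of standard monomials *)

Section GradedToPBW.
Variables (K : comPzRingType) (R : algType K) (L : R -> Prop).
Hypothesis hL : subalgebra L.
Variables (M : eqType) (z : M) (add : Monoid.com_law z) (le : M -> M -> Prop).
Hypotheses (adm : admissible add z le) (addI : right_injective add).
Hypothesis wf : well_founded (strict le).
Variable F : M -> R -> Prop.
Hypotheses (filt : is_filtration add z le F) (F0 : forall r, F z r <-> L r).
Hypothesis fg : forall a, fg_left L (F a).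
Variables (s : nat) (q : 'I_s -> 'I_s -> R).

Section Lift.
Variables (d : 'I_s -> M) (x : 'I_s -> R).
Let y := fun i => [:: (d i, x i)].
Hypothesis Fx : forall i, F (d i) (x i).
Hypothesis Gspan : forall g, gwf F g -> exists (S : seq (Nn s)) (c : Nn s -> R),
  (forall al, L (c al)) /\ geqv le F g (ylin add z y S c).
Hypothesis Gfree : forall (S : seq (Nn s)) (c : Nn s -> R), uniq S ->
  (forall al, L (c al)) -> geqv le F (ylin add z y S c) (gzero R M) ->
  forall al, al \in S -> c al = 0.

Let deg : Nn s -> M := dg add d.

Lemma filt_span a r : F a r -> mspan L x (fun al => le (deg al) a) r.
Proof.
elim/(well_founded_ind wf): a r => a IH r Fr.
have [S [c [Lc /(_ a)]]] := Gspan (gwf1 Fr).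
rewrite gcomp1 eqxx gcomp_ylin => E.
rewrite -[r](subrK (\sum_(al <- S | deg al == a) c al * xmon x al)).
apply: mspanD; last first.
  by apply: mspan_sum => // al _ /eqP ->; exact: (adm_refl adm).
case: E => [->|[b [ba Fb]]]; first exact: mspan0.
apply: mspan_mono (IH b ba _ Fb) => al alb.
by apply: (adm_trans adm) alb _; case: ba.
Qed.

Lemma Fprec_span a r : Fprec le F a r -> mspan L x (fun al => strict le (deg al) a) r.
Proof.
case=> [->|[b [ba Fb]]]; first exact: mspan0.
apply: mspan_mono (filt_span Fb) => al alb; exact: (le_strict_trans adm) ba.
Qed.

Lemma lift_free : mon_free L x.
Proof.
move=> S; move: {2}(size S).+1 (ltnSn (size S)) => n; elim: n S => // n IH S sS c uS Lc sum0.
have [->//|/eqP /(adm_seq_max adm deg)[b bS bmax]] := eqVneq S [::].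
pose top al := deg al == deg b.
(* The terms of non-maximal degree lie in [F_{<deg b}]. As the whole sum is zero, so does the top
   part, which is thus a relation in the graded algebra; [Gfree] kills its coefficients and the
   induction treats the shorter rest. *)
have top_low : Fprec le F (deg b) (\sum_(al <- S | ~~ top al) c al * xmon x al).
  apply: Ksubmodule_sum; first exact: (Fprec_Ksubmodule adm filt).
  move=> al alS /eqP ntop; right; exists (deg al); split; first by split=> //; exact: bmax.
  rewrite -[deg al](Monoid.mul1m add); apply: (filtM filt); first exact/F0.
  exact: (F_dg_xmon filt).
have c_top al : al \in S -> top al -> c al = 0.
  move=> alS topal; apply: (@Gfree [seq al <- S | top al]) => //.
  - exact: filter_uniq.
  - move=> a; rewrite [gcomp (gzero _ _) _]big_nil subr0 gcomp_ylin big_filter_cond.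
    have [->|ne] := eqVneq a (deg b); last first.
      left; rewrite big1// => be /andP[/eqP tb /eqP dba]; case/eqP: ne.
      by rewrite -tb -dba.
    under eq_bigl do rewrite andbb.
    move: sum0; rewrite (bigID top)/= => /eqP; rewrite addr_eq0 => /eqP ->.
    by apply: KsubmoduleN => //; exact: (Fprec_Ksubmodule adm filt).
  - by rewrite mem_filter topal.
move=> al alS; have [|ntop] := boolP (top al); first exact: c_top.
apply: (IH [seq al <- S | ~~ top al]) => //.
- rewrite -ltnS; apply: leq_trans sS; rewrite ltnS size_filter -(count_predC top S).
  by rewrite -addn1 addnC leq_add2r -has_count; apply/hasP; exists b; rewrite /top.
- exact: filter_uniq.
- move: sum0; rewrite (bigID top)/= big_seq_cond big1 ?add0r ?big_filter//.
  by move=> be /andP[/c_top + tb]; move=> ->//; rewrite mul0r.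
- by rewrite mem_filter ntop.
Qed.

Lemma lift_spanT r : mspan L x (fun=> True) r.
Proof. by case: filt => _ _ _ /(_ r) [a /filt_span H] _; apply: mspan_mono H. Qed.

(** One finite exponent set serves all of [F_{<a}]. Left multiplication by [L] does not enlarge
    supports, so the generators of [F a] bound the exponents, while [Fprec_span] makes their degrees
    strictly less than [a]. *)
Lemma Fprec_expand a : exists G : seq (Nn s), [/\ uniq G,
  forall al, al \in G -> strict le (deg al) a &
  forall r, Fprec le F a r -> exists c : Nn s -> R,
    (forall al, L (c al)) /\ r = \sum_(al <- G) c al * xmon x al].
Proof.
have [m [g [Fg gP]]] := fg a.
have [S SP] := choice (fun l => mcoef_expand hL lift_spanT (g l)).
exists [seq al <- undup (flatten [seq S l | l <- enum 'I_m]) |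
  `[< strict le (deg al) a >]]; split.
- by rewrite filter_uniq// undup_uniq.
- by move=> al; rewrite mem_filter => /andP[/asboolP].
move=> r lr; exists (mcoef hL lift_spanT r); split; first exact: mcoefL.
apply: mcoef_support_sum; first by rewrite filter_uniq// undup_uniq.
move=> al; rewrite mem_filter negb_and => /orP[/asboolPn nlt|].
  by move/(Fprec_span) : lr => /(mspanP hL lift_spanT lift_free); exact.
rewrite mem_undup => alS.
have /gP[c [Lc ->]] := Fprec_F filt lr.
rewrite (mcoef_bigsum _ _ lift_free) big1// => l _; rewrite mcoefMl//; last exact: lift_free.
have [_ Sl _] := SP l; rewrite Sl ?mulr0//.
apply: contra alS => alS; apply/flattenP; exists (S l) => //.
by apply: map_f; rewrite mem_enum.
Qed.

Definition deglex (al be : Nn s) : Prop :=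
  strict le (deg al) (deg be) \/ (deg al = deg be /\ lexle al be).

Lemma deglex_admissible : admissible (@Nn_add s) (Nn_zero s) deglex.
Proof.
have lex := @lexle_admissible s.
have asym a b : strict le a b -> strict le b a -> False.
  by move=> [ab ne] [ba _]; apply: ne; exact: (adm_anti adm).
split; [|split; [|split; [|split; [|split]]]].
- by move=> al; right; split=> //; exact: (adm_refl lex).
- move=> al be [lt|[e lx]] [lt'|[e' lx']].
  + by case: (asym _ _ lt lt').
  + by case: lt => _; rewrite e'.
  + by case: lt' => _; rewrite e.
  + exact: (adm_anti lex).
- move=> al be ga [lt|[e lx]] [lt'|[e' lx']].
  + by left; apply: (strict_le_trans adm lt); case: lt'.
  + by left; rewrite -e'.
  + by left; rewrite e.
  + by right; rewrite e; split=> //; exact: (adm_trans lex) lx'.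
- move=> al be; have [e|/eqP ne] := eqVneq (deg al) (deg be).
    by have [lx|lx] := adm_total lex al be; [left|right]; right.
  have [lt|lt] := adm_total adm (deg al) (deg be); [left|right]; left; split=> //.
  by move/esym.
- move=> al be ga [lt|[e lx]]; rewrite /deglex /deg !dgD; [left|right].
    exact: (strict_addr adm addI).
  by split; [congr (add _ _) | exact: (adm_addr lex)].
- move=> al; rewrite /deglex; have [e|/eqP ne] := eqVneq (deg (Nn_zero s)) (deg al).
    by right; split=> //; exact: (adm_ge0 lex).
  by left; split=> //; rewrite /deg dg0; exact: (adm_ge0 adm).
Qed.

Lemma deglex_strict al be : strict le (deg al) (deg be) -> strict deglex al be.
Proof. by move=> lt; split; [left | move=> E; case: lt => _; rewrite E]. Qed.

End Lift.

Lemma graded_ore_pbw : graded_iterated_ore add z le F L q -> pbw_presentation L q.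
Proof.
case=> d [x /= [Fx Gspan Gfree [sigma Hs]]].
have L1 : L 1 by case: hL.
pose B (j : 'I_s) g := gwf F g /\ inB add z le F L (fun i => [:: (d i, x i)]) j g.
have comm_coef k a : L a -> exists2 a', L a' & Fprec le F (d k) (x k * a - a' * x k).
  move=> La; have Bg : B k [:: (z, a)].
    split; first by apply: gwf1; exact/F0.
    exists [:: Nn_zero s], (fun=> a); split=> //.
      by move=> al; rewrite inE => /eqP -> i _; rewrite ffunE.
    apply: geqv_gcomp => b.
    by rewrite gcomp_ylin gcomp1 big_mkcond big_seq1 dg0 xmon0 mulr1.
  have [/(_ _ Bg)[wfs _] [_ [_ [_ [_ [/(_ _ Bg) E _]]]]]] := Hs k.
  (* [sigma k] is not assumed to preserve degrees, but in degree [d k] the relation involves only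
     the degree-zero component of the image of [a], and that lies in [L]. *)
  exists (gcomp (sigma k [:: (z, a)]) z); first by apply/F0; exact: (gwf_gcomp filt).
  move/(geqv_mul1P le F addI): E => /(_ z).
  by rewrite gcomp1 eqxx Monoid.mul1m.
have comm_gen (i j : 'I_s) : (i < j)%N ->
    Fprec le F (add (d i) (d j)) (x j * x i - q j i * x i * x j).
  move=> ij; have Bg : B j [:: (d i, x i)].
    split; first exact: gwf1.
    exists [:: Nn_eps i], (fun=> 1); split=> //.
      move=> al; rewrite inE => /eqP -> k jk; rewrite ffunE.
      by case: eqP => // ki; move: ij; rewrite -ki ltnNge jk.
    apply: geqv_gcomp => b; rewrite gcomp_ylin gcomp1 big_mkcond big_seq1 dg_eps mul1r.
    by rewrite xmon_eps.
  have [/(_ _ Bg)[wfs _] [_ [_ [_ [_ [/(_ _ Bg) E /(_ i ij (d i)) E']]]]]] := Hs j.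
  (* Here too only the component in degree [d i] counts. It is congruent to [q j i * x i];
     multiplying that congruence by [x j] on the right eliminates [sigma]. *)
  move/(geqv_mul1P le F addI): E => /(_ (d i)); rewrite gcomp1 eqxx => E.
  move: E'; rewrite /gmul /= gcomp1 Monoid.mul1m eqxx.
  move=> /(Fprec_mulr adm addI filt)/(_ (Fx j)); rewrite mulrBl => E'.
  case: (Fprec_Ksubmodule adm filt (add (d i) (d j))) => _ FD _.
  by have := FD _ _ E E'; rewrite addrA subrK.
have spT := lift_spanT Gspan.
have [G GP] := choice (fun a => Fprec_expand Fx Gspan Gfree a).
exists x, (deglex d), (fun j i => G (add (d i) (d j))), (fun k => G (d k)).
split; first exact: deglex_admissible.
split.
- by split=> [i j|k]; [have [] := GP (add (d i) (d j)) | have [] := GP (d k)].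
- split=> [i j ij g|k g] gG; apply: deglex_strict.
    by rewrite dgD !dg_eps; have [_ + _] := GP (add (d i) (d j)); exact.
  by rewrite dg_eps; have [_ + _] := GP (d k); exact.
- split; last exact: lift_free Fx Gfree.
  move=> r; have [S [c [_ Lc _ _ ->]]] := mspan_expand hL (spT r).
  by exists S, c.
- move=> i j /comm_gen lij; have [_ _ /(_ _ lij)[c [Lc E]]] := GP (add (d i) (d j)).
  by exists c; split=> //; rewrite -E addrC subrK.
- move=> a k /(comm_coef k)[a' La' lk]; have [_ _ /(_ _ lk)[c [Lc E]]] := GP (d k).
  by exists a', c; split=> //; rewrite -E addrC subrK.
Qed.

End GradedToPBW.

(** * The weight filtration attached to a presentation as in (iii) *)

Lemma wtD s (w : 'I_s -> nat) al be : wt w (Nn_add al be) = (wt w al + wt w be)%N.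
Proof. by rewrite /wt -big_split; apply: eq_bigr => i _; rewrite ffunE mulnDr. Qed.

Lemma wt0 s (w : 'I_s -> nat) : wt w (Nn_zero s) = 0%N.
Proof. by rewrite /wt big1// => i _; rewrite ffunE muln0. Qed.

Lemma wt_eps s (w : 'I_s -> nat) i : wt w (Nn_eps i) = w i.
Proof.
rewrite /wt (bigD1 i)//= ffunE eqxx muln1 big1 ?addn0// => j /negPf ji.
by rewrite ffunE ji muln0.
Qed.

(** Splits off the leftmost variable of a monomial, so that [xmon_mull] can put it back without
    reordering. *)
Lemma Nn_first s (al : Nn s) : al = Nn_zero s \/ exists (i : 'I_s) (be : Nn s),
  al = Nn_add be (Nn_eps i) /\ forall k : 'I_s, (k < i)%N -> be k = 0%N.
Proof.
have [->|ne] := eqVneq al (Nn_zero s); [by left | right].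
have [i0 ni0] : exists i, al i != 0%N.
  apply/existsP; apply: contraNT ne => /existsPn E; apply/eqP/ffunP => i.
  by apply/eqP; rewrite ffunE -[_ == _]negbK E.
case: (@arg_minnP _ i0 (fun i => al i != 0%N) (fun i => val i) ni0) => i ni imin.
exists i, [ffun k => (al k - (k == i))%N]; split.
  by apply/ffunP=> k; rewrite !ffunE subnK//; case: eqP => // ->; rewrite lt0n.
move=> k ki; rewrite ffunE.
suff /eqP -> : al k == 0%N by [].
by apply: contraLR ki => /imin; rewrite -leqNgt.
Qed.

Section Filtration.
Variables (K : comPzRingType) (R : algType K) (L : R -> Prop).
Hypothesis hL : subalgebra L.
Variables (s : nat) (x : 'I_s -> R).

Let ltord := fun i j : 'I_s => (i < j)%N.

(** The factors of [xmon] do not commute, so the order in which the product enumerates the indices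
    matters. *)
Lemma pairwise_index_enum : pairwise ltord (index_enum 'I_s).
Proof.
rewrite [index_enum _]unlock -enumT -(pairwise_map (@nat_of_ord s) ltn).
rewrite val_enum_ord -sorted_pairwise; last exact: ltn_trans.
exact: iota_ltn_sorted.
Qed.

Lemma xmon_mull (i : 'I_s) (al : Nn s) : (forall k : 'I_s, (k < i)%N -> al k = 0%N) ->
  x i * xmon x al = xmon x (Nn_add al (Nn_eps i)).
Proof.
move=> al0; rewrite /xmon.
elim: (index_enum _) pairwise_index_enum (mem_index_enum i) => // h e IH /=.
move=> /andP[/allP he pe]; rewrite inE !big_cons ffunE ffunE eq_sym => /predU1P[hi|ie].
  rewrite hi eqxx addn1 exprS mulrA; congr (_ * _); apply: eq_big_seq => k /he.
  by rewrite !ffunE hi => ik; rewrite -val_eqE gtn_eqF ?addn0.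
have hi := he _ ie; rewrite al0// expr0 mul1r (IH pe ie).
by rewrite -val_eqE ltn_eqF// expr0 mul1r.
Qed.

Lemma xmon_mulr (i : 'I_s) (al : Nn s) : (forall k : 'I_s, (i < k)%N -> al k = 0%N) ->
  xmon x al * x i = xmon x (Nn_add al (Nn_eps i)).
Proof.
move=> al0; rewrite /xmon.
elim: (index_enum _) pairwise_index_enum (mem_index_enum i) => // h e IH /=.
move=> /andP[/allP he pe]; rewrite inE !big_cons ffunE ffunE eq_sym => /predU1P[hi|ie].
  rewrite hi eqxx addn1 exprSr -!mulrA; congr (_ * _).
  rewrite big_seq big1 => [|k /he]; last by rewrite hi => /al0 ->.
  rewrite mul1r big_seq big1 ?mulr1// => k /he; rewrite hi => ik.
  by rewrite !ffunE al0// -val_eqE gtn_eqF.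
have hi := he _ ie.
by rewrite -mulrA (IH pe ie) -val_eqE ltn_eqF// addn0.
Qed.

Variables (w : 'I_s -> nat) (q : 'I_s -> 'I_s -> R).

(** The bound is strict: [low n] plays the role of [F_{<n}], and [low 0] is zero, matching the
    convention of [Fprec]. *)
Definition low n := mspan L x (fun al => (wt w al < n)%N).

Definition supp (j : nat) (al : Nn s) : Prop := forall i : 'I_s, (j <= i)%N -> al i = 0%N.

(* [FJ j n] is the preimage in [R_n] of the degree [n] part of [L[y_1]...[y_j]]; treating
   all [j] at once yields both the filtration and the tower of Ore extensions. *)
Definition FJ (j n : nat) :=
  mspan L x (fun al => (wt w al < n)%N \/ (wt w al = n /\ supp j al)).

Hypothesis w_gt0 : forall i, (0 < w i)%N.
Hypothesis hq : forall i j : 'I_s, (i < j)%N -> L (q j i).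
Hypothesis comm_gen : forall i j : 'I_s, (i < j)%N ->
  exists2 r, low (w i + w j) r & x j * x i = q j i * x i * x j + r.
Hypothesis comm_coef : forall (k : 'I_s) a, L a ->
  exists a' r, [/\ L a', low (w k) r & x k * a = a' * x k + r].

Let L1 : L 1. Proof. by case: hL. Qed.

Lemma supp_full al : supp s al.
Proof. by move=> i; rewrite leqNgt ltn_ord. Qed.

Lemma supp0 j : supp j (Nn_zero s).
Proof. by move=> i _; rewrite ffunE. Qed.

Lemma supp_eps (j : nat) (i : 'I_s) : (i < j)%N -> supp j (Nn_eps i).
Proof.
move=> ij k jk; rewrite ffunE; case: eqP => // ki.
by move: ij; rewrite -ki ltnNge jk.
Qed.

Lemma suppD j al be : supp j al -> supp j be -> supp j (Nn_add al be).
Proof. by move=> ha hb i ji; rewrite ffunE ha// hb. Qed.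

Lemma suppDl j al be : supp j (Nn_add al be) -> supp j al.
Proof. by move=> h i /h /eqP; rewrite ffunE addn_eq0 => /andP[/eqP]. Qed.

Lemma suppDeps j al (i : 'I_s) : supp j (Nn_add al (Nn_eps i)) -> (i < j)%N.
Proof.
move=> h; rewrite ltnNge; apply/negP => /h /eqP.
by rewrite !ffunE eqxx addn_eq0 andbF.
Qed.

Lemma low0 r : low 0 r -> r = 0. Proof. by case. Qed.

Lemma low_FJ j n r : low n r -> FJ j n r.
Proof. by apply: mspan_mono => al; left. Qed.

Lemma FJ_full j n r : FJ j n r -> FJ s n r.
Proof. by apply: mspan_mono => al [|[]]; [left | right; split=> //; exact: supp_full]. Qed.

Lemma low_lt_F m n r : (m < n)%N -> FJ s m r -> low n r.
Proof. by move=> mn; apply: mspan_mono => al; lia. Qed.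

Lemma low_F n r : low n.+1 r <-> FJ s n r.
Proof.
split; last exact: low_lt_F.
apply: mspan_mono => al; rewrite ltnS leq_eqVlt => /orP[/eqP|]; last by left.
by right; split=> //; exact: supp_full.
Qed.

Lemma F_le m n r : (m <= n)%N -> FJ s m r -> FJ s n r.
Proof.
move=> mn; apply: mspan_mono => al H.
have [|ge] := ltnP (wt w al) n; [by left | right; split; [lia | exact: supp_full]].
Qed.

Lemma FJ_xmon j al : supp j al -> FJ j (wt w al) (xmon x al).
Proof. by move=> sal; rewrite -[xmon _ _]mul1r; apply: mspan_mon => //; right. Qed.

Lemma FJ_x (j : nat) (i : 'I_s) : (i < j)%N -> FJ j (w i) (x i).
Proof.
by move=> ij; rewrite -(wt_eps w i) -(xmon_eps x i); apply: FJ_xmon; exact: supp_eps.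
Qed.

Lemma F_x i : FJ s (w i) (x i). Proof. exact: FJ_x. Qed.

Lemma FJ_L j c : L c -> FJ j 0 c.
Proof.
move=> Lc; rewrite -[c]mulr1 -(xmon0 x); apply: mspan_mon => //.
by right; rewrite wt0; split=> //; exact: supp0.
Qed.

(** Taking [j = s] gives multiplicativity of the filtration; smaller [j] say that the top parts stay
    in the first [j] variables. The induction on [a + b] ranges over all [j], since lower terms may
    involve any variable and need the case [j = s]. *)
Lemma FJ_mul j a b r t : FJ j a r -> FJ j b t -> FJ j (a + b) (r * t).
Proof.
move: {2}(a + b).+1%N (ltnSn (a + b)) => N; elim: N j a b r t => // N IH j a b r t.
(* An element of [low] at a successor lies in [FJ s] at its predecessor; the total weight drops by
   one, within reach of [IH]. *)
have lowMl a' b' r' t' : (a' + b' <= N)%N -> low a' r' -> FJ s b' t' -> low (a' + b') (r' * t').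
  case: a' => [_ /low0 -> _|a' le /low_F fr ft]; first by rewrite mul0r; exact: mspan0.
  by apply/low_F; apply: IH.
have lowMr a' b' r' t' : (a' + b' <= N)%N -> FJ s a' r' -> low b' t' -> low (a' + b') (r' * t').
  case: b' => [_ _ /low0 ->|b' le fr /low_F ft]; first by rewrite mulr0; exact: mspan0.
  by rewrite addnS in le *; apply/low_F; apply: IH.
(* Left multiplication by one variable, by an inner induction on its index. When [x k] meets a
   leftmost variable [x i] with [i < k], the swap leaves [x i * (x k * x^be)]: the inner product has
   smaller total weight because [w i > 0], so [IH] applies, and then [i < k] allows [IHm]. *)
have Q (k : 'I_s) : (k < j)%N -> forall b' t', (w k + b' <= N)%N -> FJ j b' t' ->
    FJ j (w k + b') (x k * t').
  move: {2}k.+1 (ltnSn k) => m; elim: m k => // m IHm k km kj b' t' le.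
  elim=> [|c al u Lc Tal _ IHu]; first by rewrite mulr0; exact: mspan0.
  rewrite mulrDr; apply: mspanD => //.
  have [c' [u' [Lc' lu' E]]] := comm_coef k Lc.
  have Fal : FJ s b' (xmon x al).
    apply: (@F_le (wt w al)); last by apply: FJ_xmon; exact: supp_full.
    by case: Tal => [/ltnW//|[->]].
  rewrite mulrA E mulrDl -mulrA; apply: mspanD; last exact/low_FJ/lowMl.
  apply: mspanMl => //; case: Tal => [lt|[walE sal]].
    apply/low_FJ/lowMr => //; first exact: F_x.
    by rewrite -[xmon _ _]mul1r; exact: mspan_mon.
  rewrite -walE in le *.
  case: (Nn_first al) => [->|[i [be [alE be0]]]].
    rewrite xmon_mull => [|l _]; last by rewrite ffunE.
    rewrite wt0 addn0 -(wt_eps w k) Nn_add0; apply: FJ_xmon; exact: supp_eps.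
  have [ki|ik] := leqP k i.
    rewrite xmon_mull => [|l lk]; last first.
      rewrite alE !ffunE be0 ?add0n; last exact: leq_trans ki.
      by rewrite -val_eqE ltn_eqF//; exact: leq_trans ki.
    rewrite -[w k](wt_eps w) addnC -wtD; apply: FJ_xmon.
    by apply: suppD => //; exact: supp_eps.
  have sbe : supp j be by apply: suppDl (_ : supp j (Nn_add be (Nn_eps i))); rewrite -alE.
  have wtal : wt w al = (wt w be + w i)%N by rewrite alE wtD wt_eps.
  have wi := w_gt0 i.
  rewrite wtal in le.
  have [u'' lu'' E'] := comm_gen ik.
  rewrite alE -xmon_mull// mulrA E' mulrDl; apply: mspanD; last first.
    apply: low_FJ; have -> : (w k + wt w (Nn_add be (Nn_eps i)) = w i + w k + wt w be)%N.
      by rewrite -alE wtal; lia.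
    by apply: lowMl => //; [lia | apply: FJ_xmon; exact: supp_full].
  rewrite -!mulrA; apply: (mspanMl hL); first exact: hq.
  have -> : (w k + wt w (Nn_add be (Nn_eps i)) = w i + (w k + wt w be))%N.
    by rewrite -alE wtal; lia.
  apply: IHm => //; [lia|lia|lia|].
  by apply: IH; [lia | exact: FJ_x | exact: FJ_xmon].
rewrite ltnS => le + ft; have fts := FJ_full ft.
elim=> [|c al u Lc Tal _ IHu]; first by rewrite mul0r; exact: mspan0.
rewrite mulrDl; apply: mspanD => //; rewrite -mulrA; apply: mspanMl => //.
case: Tal => [lt|[walE sal]].
  apply/low_FJ/lowMl => //.
  by rewrite -[xmon _ _]mul1r; exact: mspan_mon.
case: (Nn_first al) => [al0|[i [be [alE be0]]]].
  by rewrite al0 xmon0 mul1r -walE al0 wt0.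
have ij : (i < j)%N by apply: (@suppDeps _ be); rewrite -alE.
have sbe : supp j be by apply: suppDl (_ : supp j (Nn_add be (Nn_eps i))); rewrite -alE.
have wi := w_gt0 i.
have aE : a = (w i + wt w be)%N by rewrite -walE alE wtD wt_eps addnC.
rewrite alE -xmon_mull// -mulrA aE -addnA; apply: Q => //; first by lia.
by apply: IH => //; [lia | exact: FJ_xmon].
Qed.

Lemma low_mull a b r t : low a r -> FJ s b t -> low (a + b) (r * t).
Proof.
case: a => [/low0 -> _|a /low_F fr ft]; first by rewrite mul0r; exact: mspan0.
by apply/low_F; exact: FJ_mul.
Qed.

Lemma low_mulr a b r t : FJ s a r -> low b t -> low (a + b) (r * t).
Proof.
case: b => [_ /low0 ->|b fr /low_F ft]; first by rewrite mulr0; exact: mspan0.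
by rewrite addnS; apply/low_F; exact: FJ_mul.
Qed.

(* The relation behind [sigma_j] on homogeneous components: it is stable under
   products, so it suffices to check it on [L] and on the [x_i] with [i < j]. *)
Lemma sigma_exists (j : 'I_s) n r : FJ j n r ->
  exists2 t, FJ j n t & low (n + w j) (x j * r - t * x j).
Proof.
pose P m u := exists2 t, FJ j m t & low (m + w j) (x j * u - t * x j).
rewrite -/(P n r).
have PM m m' u u' : FJ j m' u' -> P m u -> P m' u' -> P (m + m')%N (u * u').
  move=> fu' [t ft lt] [t' ft' lt']; exists (t * t'); first exact: FJ_mul.
  have -> : x j * (u * u') - t * t' * x j =
      (x j * u - t * x j) * u' + t * (x j * u' - t' * x j).
    by rewrite mulrBl mulrBr !mulrA addrA subrK.
  apply: mspanD; first by rewrite addnAC; apply: low_mull => //; exact: FJ_full fu'.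
  by rewrite -addnA; apply: low_mulr => //; exact: FJ_full ft.
have PL c : L c -> P 0%N c.
  move=> Lc; have [c' [u [Lc' lu E]]] := comm_coef j Lc.
  by exists c'; [exact: FJ_L | rewrite E addrC addKr].
have Px (i : 'I_s) : (i < j)%N -> P (w i) (x i).
  move=> ij; have [u lu E] := comm_gen ij; exists (q j i * x i).
    by apply: (mspanMl hL); [exact: hq | exact: FJ_x].
  by rewrite E addrC addKr.
have Pmon al : supp j al -> P (wt w al) (xmon x al).
  move: {2}(wt w al).+1 (ltnSn (wt w al)) => N; elim: N al => // N IH al le sal.
  case: (Nn_first al) => [->|[i [be [alE be0]]]]; first by rewrite wt0 xmon0; exact: PL.
  have ij : (i < j)%N by apply: (@suppDeps _ be); rewrite -alE.
  have sbe : supp j be by apply: suppDl (_ : supp j (Nn_add be (Nn_eps i))); rewrite -alE.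
  have wi := w_gt0 i; move: le; rewrite alE -xmon_mull// wtD wt_eps addnC => le.
  apply: PM; [exact: FJ_xmon | exact: Px | apply: IH => //; lia].
elim=> [|c al u Lc Tal _ [t' ft' lt']].
  by exists 0; [exact: mspan0 | rewrite mulr0 mul0r subr0; exact: mspan0].
suff [t ft lt] : P n (c * xmon x al).
  exists (t + t'); first exact: mspanD.
  by rewrite mulrDr mulrDl opprD addrACA; exact: mspanD.
case: Tal => [lt|[<- sal]]; last first.
  by rewrite -[wt w al]add0n; apply: PM; [exact: FJ_xmon | exact: PL | exact: Pmon].
(* A term of weight below [n] has zero class in degree [n], so its image can be taken to be zero. *)
exists 0; first exact: mspan0.
rewrite mul0r subr0 addnC; apply: low_mulr; first exact: F_x.
exact: mspan_mon.
Qed.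

Hypothesis spanT : forall r, mspan L x (fun=> True) r.
Hypothesis free : mon_free L x.

(** Top terms involve only variables before [x j], so appending [x j] on the right shifts their
    exponents without reordering and keeps their coefficients. This is the injectivity of right
    multiplication by [y_j]. *)
Lemma low_mulr_cancel (j : 'I_s) n r : FJ j n r -> low (n + w j) (r * x j) -> low n r.
Proof.
move=> /(mspan_expand hL)[S [c [uS Lc ST cS ->]]].
have topP al : al \in S -> ~~ (wt w al < n)%N -> wt w al = n /\ supp j al.
  by move=> /ST [->|//].
have lowS : low n (\sum_(al <- S | (wt w al < n)%N) c al * xmon x al).
  exact: mspan_sum.
rewrite (bigID (fun al => wt w al < n)%N)/= mulrDl => H; apply: mspanD => //.
have {H} : low (n + w j) ((\sum_(al <- S | ~~ (wt w al < n)%N) c al * xmon x al) * x j).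
  rewrite -[X in low _ X](addKr ((\sum_(al <- S | (wt w al < n)%N) c al * xmon x al) * x j)).
  rewrite addrC; apply: mspanB => //; apply: low_mull => //; exact: F_x.
pose sh (al : Nn s) := Nn_add al (Nn_eps j).
have shI : injective sh by move=> a b; rewrite /sh ![Nn_add _ (Nn_eps j)]Nn_addC => /Nn_addI.
(* The coefficients transported along the shift [sh]; truncated subtraction inverts [sh] on its
   image. *)
pose c' be := c [ffun k => (be k - (k == j))%N].
have c'sh al : c' (sh al) = c al.
  by congr c; apply/ffunP => k; rewrite !ffunE addnK.
pose top := [seq al <- S | ~~ (wt w al < n)%N].
have -> : (\sum_(al <- S | ~~ (wt w al < n)%N) c al * xmon x al) * x j =
    \sum_(be <- map sh top) c' be * xmon x be.
  rewrite big_map big_filter mulr_suml big_seq_cond [RHS]big_seq_cond.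
  apply: eq_bigr => al /andP[alS nlt]; have [_ sal] := topP _ alS nlt.
  by rewrite c'sh -mulrA xmon_mulr// => k /ltnW; exact: sal.
move=> /(mspanP hL spanT free) H.
rewrite big_seq_cond big1; first exact: mspan0.
move=> al /andP[alS nlt]; have [wal _] := topP _ alS nlt.
have /H : ~ (wt w (sh al) < n + w j)%N by rewrite /sh wtD wt_eps wal ltnn.
have Lc' be : L (c' be) by exact: Lc.
rewrite (mcoef_sum hL spanT free) ?map_inj_uniq ?filter_uniq//.
by rewrite mem_map// mem_filter nlt alS c'sh /= => E; rewrite E mul0r.
Qed.

Lemma le_wt (al : Nn s) i : (al i <= wt w al)%N.
Proof.
rewrite /wt (bigD1 i)//=; apply: leq_trans (leq_addr _ _).
by rewrite leq_pmull.
Qed.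

(** Positive weights bound each exponent by the total weight, so maps into ['I_n.+1] exhaust the
    candidates. This is the source of finite generation of the filtration steps. *)
Lemma wt_finite n : exists S : seq (Nn s),
  uniq S /\ forall al, (al \in S) = (wt w al <= n)%N.
Proof.
pose emb (f : {ffun 'I_s -> 'I_n.+1}) : Nn s := [ffun i => val (f i)].
exists (undup [seq al <- map emb (enum {ffun 'I_s -> 'I_n.+1}) | (wt w al <= n)%N]).
split=> [|al]; first exact: undup_uniq.
rewrite mem_undup mem_filter andb_idr// => le; apply/mapP.
exists [ffun i => inord (al i)]; first by rewrite mem_enum.
apply/ffunP=> i; rewrite !ffunE /= inordK// ltnS; exact: leq_trans (le_wt al i) le.
Qed.

Lemma FJ0 r : FJ s 0 r -> L r.
Proof.
have [[LZ LD _] _ LM] := hL.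
elim=> [//|c al t Lc Tal _ Lt]; apply: LD => //.
suff -> : al = Nn_zero s by rewrite xmon0 mulr1.
apply/ffunP=> i; rewrite ffunE; apply/eqP; rewrite -leqn0.
by apply: leq_trans (le_wt al i) _; case: Tal => [|[->]].
Qed.

Lemma F_exhaustive r : exists n, FJ s n r.
Proof.
elim: (spanT r) => [|c al t Lc _ _ [n ft]]; first by exists 0%N; exact: mspan0.
exists (maxn (wt w al) n); apply: mspan_cons => //.
  have [e|ne] := eqVneq (wt w al) (maxn (wt w al) n); last by left; lia.
  by right; split=> //; exact: supp_full.
by apply: F_le ft; exact: leq_maxr.
Qed.

Lemma F_fg n : fg_left L (FJ s n).
Proof.
have [S [uS SP]] := wt_finite n.
have Fmon al : al \in S -> FJ s n (xmon x al).
  by rewrite SP => le; apply: F_le le _; apply: FJ_xmon; exact: supp_full.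
exists (size S), (fun k => xmon x (nth (Nn_zero s) S k)); split.
  by move=> k; apply: Fmon; exact: mem_nth.
move=> r; split=> [fr|[c [Lc ->]]]; last first.
  apply: Ksubmodule_sum => [|k _ _]; first exact: mspan_Ksubmodule.
  by apply: mspanMl => //; apply: Fmon; exact: mem_nth.
exists (fun k => mcoef hL spanT r (nth (Nn_zero s) S k)); split.
  by move=> k; exact: mcoefL.
rewrite {1}(@mcoef_support_sum _ _ _ hL _ x spanT S r uS).
  by rewrite (big_nth (Nn_zero s)) big_mkord.
move=> al; rewrite SP -ltnNge => lt; move/(mspanP hL spanT free): fr; apply.
by lia.
Qed.

(** * The endomorphisms [sigma_j] and the tower of Ore extensions *)

Section GradedOre.
Variables (M : eqType) (z : M) (add : Monoid.com_law z).
Variables (phi : M -> nat) (psi : nat -> M).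
Hypotheses (phiK : cancel phi psi) (psiK : cancel psi phi).
Hypothesis phiD : forall a b, phi (add a b) = (phi a + phi b)%N.

(** The usual order and the weight filtration are transported along an additive bijection [phi] from
    [M] to [nat], so that [nat] and [Nn 1] are treated at once. *)
Definition phile (a b : M) : Prop := (phi a <= phi b)%N.
Definition FM (a : M) : R -> Prop := FJ s (phi a).

Let phi0 : phi z = 0%N.
Proof. by have := phiD z z; rewrite Monoid.mul1m; lia. Qed.

Lemma phile_admissible : admissible add z phile.
Proof.
split; [by move=> a; exact: leqnn | split; [|split; [|split; [|split]]]].
- by move=> a b ab ba; apply: (can_inj phiK); apply/eqP; rewrite eqn_leq ab.
- by move=> a b c; exact: leq_trans.
- by move=> a b; apply/orP; exact: leq_total.
- by move=> a b c; rewrite /phile !phiD leq_add2r.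
- by move=> a; rewrite /phile phi0.
Qed.

Lemma phi_addI : right_injective add.
Proof.
move=> c a b /(congr1 phi); rewrite !phiD => /addnI; exact: (can_inj phiK).
Qed.

Lemma FM_filtration : is_filtration add z phile FM.
Proof.
split.
- by move=> a; exact: mspan_Ksubmodule.
- by move=> a b ab r; exact: F_le.
- by move=> a b r t; rewrite /FM phiD; exact: FJ_mul.
- by move=> r; have [n Fr] := F_exhaustive r; exists (psi n); rewrite /FM psiK.
- by rewrite /FM phi0; exact: FJ_L.
Qed.

Lemma FM0 r : FM z r <-> L r.
Proof. by rewrite /FM phi0; split; [exact: FJ0 | exact: FJ_L]. Qed.

Let adm := phile_admissible.
Let addI := phi_addI.
Let filt := FM_filtration.

Let d i := psi (w i).
Let y i : gelt R M := [:: (d i, x i)].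

Lemma phi_dg al : phi (dg add d al) = wt w al.
Proof.
rewrite /dg (big_morph phi phiD phi0); apply: eq_bigr => i _.
elim: (al i) => [|k IH]; first by rewrite phi0 muln0.
by rewrite iterS phiD IH psiK mulnS.
Qed.

Lemma FprecP a r : Fprec phile FM a r <-> low (phi a) r.
Proof.
split=> [[->|[b [[ba ne] Fb]]]|].
- exact: mspan0.
- apply: low_lt_F Fb; rewrite ltn_neqAle ba andbT.
  by apply/eqP => /(can_inj phiK).
- case E: (phi a) => [|n]; first by move/low0 => ->; left.
  move/low_F => Fr; right; exists (psi n); split; last by rewrite /FM psiK.
  by split=> [|na]; [rewrite /phile psiK E | move: E; rewrite -na psiK; lia].
Qed.

Lemma FM_x i : FM (d i) (x i).
Proof. by rewrite /FM psiK; exact: F_x. Qed.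

Lemma gcomp_expand j g : gwf FM g -> (forall a, FJ j (phi a) (gcomp g a)) ->
  exists (S : seq (Nn s)) (c : Nn s -> R),
    [/\ forall al, L (c al), forall al, al \in S -> supp j al
      & geqv phile FM g (ylin add z y S c)].
Proof.
(* [N] dominates every degree occurring in [g], so monomials of larger weight meet only zero
   components. *)
move=> wg Fg; pose N := (\sum_(p <- g) phi p.1)%N.
have [U [uU UP]] := wt_finite N.
pose S := [seq al <- U | `[< supp j al >]].
(* The coefficient of [al] is read off the component whose degree is the weight of [al]; in other
   components this monomial does not count towards the class. *)
pose c al := mcoef hL spanT (gcomp g (psi (wt w al))) al.
have Lc al : L (c al) by exact: mcoefL.
have uS : uniq S by exact: filter_uniq.
exists S, c; split=> //; first by move=> al; rewrite mem_filter => /andP[/asboolP].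
move=> a; apply/FprecP/(mspanP hL spanT free) => be nlt.
rewrite gcomp_ylin (mcoefB _ _ free) (mcoef_sum _ _ free)//.
case: ifP => [/andP[_ /eqP ba]|nS].
  by rewrite /c -phi_dg phiK ba subrr.
rewrite subr0; have [wa|ne] := eqVneq (wt w be) (phi a); last first.
  by move/(mspanP hL spanT free): (Fg a); apply=> -[//|[e _]]; case/eqP: ne.
have ba : dg add d be = a by apply: (can_inj phiK); rewrite phi_dg.
move: nS; rewrite ba eqxx andbT mem_filter UP => /negbT; rewrite negb_and.
case/orP=> [/asboolPn nsupp|].
  by move/(mspanP hL spanT free): (Fg a); apply=> -[//|[]].
rewrite -ltnNge wa => lt; rewrite gcomp_notin ?(mcoef0 _ _ free)//.
apply/negP => /mapP[p pg ap]; move: lt; rewrite ltnNge /N (big_rem p)//= ap.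
by rewrite leq_addr.
Qed.

Definition inBM (j : nat) g := gwf FM g /\ inB add z phile FM L y j g.

(** Replaces the existential expansion in [inB] by a test on components, so that closure under sums
    and products is inherited from [FJ]. *)
Lemma inBMP j g : inBM j g <-> gwf FM g /\ forall a, FJ j (phi a) (gcomp g a).
Proof.
split=> -[wg H]; split=> //; last by have [S [c []]] := gcomp_expand wg H; exists S, c.
have [S [c [Lc ST E]]] := H => a.
rewrite -[gcomp g a](subrK (gcomp (ylin add z y S c) a)); apply: mspanD.
  by apply: low_FJ; apply/FprecP; exact: E.
rewrite gcomp_ylin; apply: mspan_sum => // al alS /eqP <-.
by right; rewrite phi_dg; split=> // i; exact: ST.
Qed.

Lemma inBM1 j a r : FJ j (phi a) r -> inBM j [:: (a, r)].
Proof.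
move=> Fr; apply/inBMP; split; first by apply: gwf1; exact: FJ_full Fr.
by move=> b; rewrite gcomp1; case: eqP => [<-|_]; [|exact: mspan0].
Qed.

Lemma inBM_cat j g h : inBM j g -> inBM j h -> inBM j (g ++ h).
Proof.
move=> /inBMP[wg Fg] /inBMP[wh Fh]; apply/inBMP; split; first exact: gwf_cat.
by move=> a; rewrite gcomp_cat; apply: mspanD; [exact: Fg | exact: Fh].
Qed.

Lemma inBM_gmul j g h : inBM j g -> inBM j h -> inBM j (gmul add g h).
Proof.
move=> /inBMP[wg Fg] /inBMP[wh Fh]; apply/inBMP; split.
  exact: (gwf_gmul filt).
move=> c; rewrite gcomp_gmul_partition.
apply: Ksubmodule_sum => [|a _ _]; first exact: mspan_Ksubmodule.
have [[b <-]|nb] := EM (exists b, add a b = c).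
  by rewrite sum_shift_l//; rewrite phiD; exact: FJ_mul.
rewrite big1 ?mulr0; first exact: mspan0.
by move=> p /eqP E; case: nb; exists p.1.
Qed.

Lemma sigma_gelt (j : 'I_s) g : inBM j g -> exists h,
  inBM j h /\ geqv phile FM (gmul add (y j) g) (gmul add h (y j)).
Proof.
move=> /inBMP[wg Fg].
have /choice[t tP] a : exists t, FJ j (phi a) t /\
    low (phi a + w j) (x j * gcomp g a - t * x j).
  by have [t ft lt] := sigma_exists (Fg a); exists t.
(* Removing duplicates makes each degree occur once, so that the component of [h] at [a] is [t a]
   itself and not a multiple of it. *)
pose h : gelt R M := [seq (a, t a) | a <- undup (map fst g)].
have hE a : gcomp h a = if a \in map fst g then t a else 0.
  rewrite /gcomp big_map /= -(mem_undup (map fst g)); case: ifP => ag.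
    by rewrite -big_filter filter_pred1_uniq ?undup_uniq// big_seq1.
  by rewrite big1_seq// => b /andP[/eqP -> ]; rewrite ag.
exists h; split.
  apply/inBMP; split=> [_ /mapP[a _ ->]|a]; first exact: FJ_full (proj1 (tP a)).
  by rewrite hE; case: ifP => _; [exact: (proj1 (tP a)) | exact: mspan0].
apply/(geqv_mul1P _ _ addI) => a; apply/FprecP; rewrite phiD psiK hE.
case: ifPn => ag; first exact: (proj2 (tP a)).
by rewrite gcomp_notin// mulr0 mul0r subrr; exact: mspan0.
Qed.

Lemma sigma_unique (j : 'I_s) g h : inBM j g -> inBM j h ->
  geqv phile FM (gmul add g (y j)) (gmul add h (y j)) -> geqv phile FM g h.
Proof.
move=> /inBMP[wg Fg] /inBMP[wh Fh] E a; apply/FprecP.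
apply: (@low_mulr_cancel j).
  by apply: (mspanB hL); [exact: Fg | exact: Fh].
have /FprecP := E (add a (d j)).
by rewrite !gcomp_gmul1r// phiD psiK mulrBl.
Qed.

Lemma FM_graded_ore : graded_iterated_ore add z phile FM L q.
Proof.
exists d, x => /=; split.
- exact: FM_x.
- move=> g wg; have [|S [c [Lc _ E]]] := @gcomp_expand s g wg; last by exists S, c.
  by move=> a; exact: (gwf_gcomp filt).
- move=> S c uS Lc E al alS.
  have /FprecP := E (dg add d al).
  rewrite [gcomp (gzero _ _) _]big_nil subr0 gcomp_ylin phi_dg.
  move/(mspanP hL spanT free)/(_ al); rewrite (mcoef_sum _ _ free)// alS eqxx.
  by apply; rewrite ltnn.
have /choice[sg sgP] (p : 'I_s * gelt R M) : exists h, inBM p.1 p.2 ->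
    inBM p.1 h /\ geqv phile FM (gmul add (y p.1) p.2) (gmul add h (y p.1)).
  have [Bp|nBp] := EM (inBM p.1 p.2); last by exists [::].
  by have [h hP] := sigma_gelt Bp; exists h.
exists (fun j g => sg (j, g)) => j /=.
pose sig g := sg (j, g).
have sigB g : inBM j g -> inBM j (sig g) by move=> /(sgP (j, g))[].
have sigE g : inBM j g -> geqv phile FM (gmul add (y j) g) (gmul add (sig g) (y j)).
  by move=> /(sgP (j, g))[].
have wy : gwf FM (y j) by apply: gwf1; exact: FM_x.
(* All the laws of an endomorphism follow from this uniqueness: it is enough that the expected value
   [h] satisfies [y_j g = h y_j]. *)
have sigU g h : inBM j g -> inBM j h ->
    geqv phile FM (gmul add (y j) g) (gmul add h (y j)) -> geqv phile FM (sig g) h.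
  move=> Bg Bh E; apply: (@sigma_unique j) => //; first exact: sigB.
  by apply: (geqv_trans adm filt) E; apply: (geqv_sym adm filt); exact: sigE.
have B1 : inBM j (gone R z) by apply: inBM1; rewrite phi0; exact: FJ_L.
split; first exact: sigB.
split.
  move=> g h Bg Bh gh; apply: sigU; rewrite //; first exact: sigB.
  apply: (geqv_trans adm filt) (sigE _ Bh).
  exact: (geqv_gmull adm addI filt).
split.
  move=> g h Bg Bh; apply: sigU; [exact: inBM_cat | by apply: inBM_cat; exact: sigB|].
  rewrite gmul_catl.
  apply: (geqv_trans adm filt) (_ : geqv _ _ (gmul add (y j) g ++ gmul add (y j) h) _).
    by apply: geqv_gcomp => a; exact: gcomp_gmul_catr.
  by apply: (geqv_cat adm filt); exact: sigE.
split.
  move=> g h Bg Bh; have [wg _] := Bg; have [wh _] := Bh.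
  have [wsg _] := sigB _ Bg.
  apply: sigU; [exact: inBM_gmul | by apply: inBM_gmul; exact: sigB |].
  apply: (geqv_trans adm filt) (_ : geqv _ _ (gmul add (gmul add (y j) g) h) _).
    by apply: geqv_gcomp => a; rewrite gcomp_gmulA.
  apply: (geqv_trans adm filt) (geqv_gmulr adm addI filt wh (sigE _ Bg)) _.
  apply: (geqv_trans adm filt) (_ : geqv _ _ (gmul add (sig g) (gmul add (y j) h)) _).
    by apply: geqv_gcomp => a; rewrite gcomp_gmulA.
  apply: (geqv_trans adm filt) (geqv_gmull adm addI filt wsg (sigE _ Bh)) _.
  by apply: geqv_gcomp => a; rewrite gcomp_gmulA.
split.
  apply: sigU => //; apply: geqv_gcomp => a.
  by rewrite /gmul /= Monoid.mulm1 Monoid.mul1m mulr1 mul1r.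
split; first exact: sigE.
move=> i ij; apply: sigU.
- by apply: inBM1; rewrite psiK; exact: FJ_x.
- apply: inBM_gmul; apply: inBM1.
    by rewrite phi0; apply: FJ_L; exact: hq.
  by rewrite psiK; exact: FJ_x.
- apply/(geqv_mul1P _ _ addI) => a; apply/FprecP; rewrite phiD psiK /gmul /= !gcomp1.
  rewrite Monoid.mul1m; case: eqP => [<-|_]; last first.
    by rewrite mulr0 mul0r subrr; exact: mspan0.
  have [r lr ->] := comm_gen ij.
  by rewrite psiK addrC addKr.
Qed.

End GradedOre.
End Filtration.

(** * Assembling the equivalences *)

Lemma pbw_graded_ore (K : comPzRingType) (R : algType K) (L : R -> Prop)
    (s : nat) (q : 'I_s -> 'I_s -> R) (M : eqType) (z : M) (add : Monoid.com_law z)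
    (phi : M -> nat) (psi : nat -> M) :
  subalgebra L -> (forall i j : 'I_s, (i < j)%N -> L (q j i)) ->
  cancel phi psi -> cancel psi phi ->
  (forall a b, phi (add a b) = (phi a + phi b)%N) ->
  pbw_presentation L q ->
  exists F : M -> R -> Prop,
    [/\ is_filtration add z (phile phi) F, (forall r, F z r <-> L r),
        (forall a, fg_left L (F a)) & graded_iterated_ore add z (phile phi) F L q].
Proof.
move=> hL hq phiK psiK phiD.
case=> x [le [G2 [G1 [adm [_ [G2lt G1lt] [hspan free] hgen hcoef]]]]].
(* [V2] and [V1] list all strict comparisons that (iii) requires; the weights have to respect only
   these, and then every correction term is [low]. *)
pose V2 := flatten [seq [seq (g, Nn_add (Nn_eps p.1) (Nn_eps p.2)) | g <- G2 p.2 p.1]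
  | p <- [seq p : 'I_s * 'I_s <- enum {: 'I_s * 'I_s} | (p.1 < p.2)%N]].
pose V1 := flatten [seq [seq (g, Nn_eps k) | g <- G1 k] | k <- enum 'I_s].
have [|w [w_gt0 wP]] := @admissible_weights s le (V2 ++ V1) adm.
  move=> p; rewrite mem_cat => /orP[]/flattenP[_ /mapP[k + ->] /mapP[g gG ->]] /=.
    by rewrite mem_filter => /andP[k12 _]; exact: G2lt.
  by move=> _; exact: G1lt.
have w2 (i j : 'I_s) g : (i < j)%N -> g \in G2 j i -> (wt w g < w i + w j)%N.
  move=> ij gG; have := wP (g, Nn_add (Nn_eps i) (Nn_eps j)).
  rewrite /= wtD !wt_eps; apply; rewrite mem_cat; apply/orP; left.
  apply/flattenP; exists [seq (g, Nn_add (Nn_eps i) (Nn_eps j)) | g <- G2 j i].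
    by apply/mapP; exists (i, j) => //; rewrite mem_filter ij mem_enum.
  exact: (map_f (fun g => (g, Nn_add (Nn_eps i) (Nn_eps j)))).
have w1 (k : 'I_s) g : g \in G1 k -> (wt w g < w k)%N.
  move=> gG; have := wP (g, Nn_eps k).
  rewrite /= wt_eps; apply; rewrite mem_cat; apply/orP; right.
  apply/flattenP; exists [seq (g, Nn_eps k) | g <- G1 k].
    by apply/mapP; exists k => //; rewrite mem_enum.
  exact: (map_f (fun g => (g, Nn_eps k))).
have spanT r : mspan L x (fun=> True) r.
  by have [S [c [Lc ->]]] := hspan r; exact: mspan_of_sum.
have cg (i j : 'I_s) : (i < j)%N ->
    exists2 r, low L x w (w i + w j) r & x j * x i = q j i * x i * x j + r.
  move=> ij; have [c [Lc E]] := hgen i j ij.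
  exists (\sum_(al <- G2 j i) c al * xmon x al) => //.
  by apply: mspan_sum => // al alG _; exact: w2.
have cc (k : 'I_s) a : L a ->
    exists a' r, [/\ L a', low L x w (w k) r & x k * a = a' * x k + r].
  move=> La; have [a' [c [La' Lc E]]] := hcoef a k La.
  exists a', (\sum_(al <- G1 k) c al * xmon x al); split=> //.
  by apply: mspan_sum => // al alG _; exact: w1.
exists (FM L x w phi); split.
- exact: (FM_filtration hL w_gt0 hq cg cc spanT psiK phiD).
- exact: FM0.
- by move=> a; exact: F_fg.
- exact: (FM_graded_ore hL w_gt0 hq cg cc spanT free phiK psiK phiD).
Qed.

Theorem theorem1 (K : comPzRingType) (R : algType K) (L : R -> Prop)
  (s : nat) (q : 'I_s -> 'I_s -> R)
  (hL : subalgebra L) (hnoeth : left_noetherian L) (hs : (0 < s)%N)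
  (hq : forall i j : 'I_s, (i < j)%N -> L (q j i)) :
  let cond_i :=
    exists (n : nat) (le : Nn n -> Nn n -> Prop) (F : Nn n -> R -> Prop),
      [/\ admissible (@Nn_add n) (Nn_zero n) le,
          is_filtration (@Nn_add n) (Nn_zero n) le F,
          (forall r, F (Nn_zero n) r <-> L r),
          (forall a, fg_left L (F a))
        & graded_iterated_ore (@Nn_add n) (Nn_zero n) le F L q] in
  let cond_ii :=
    exists F : nat -> R -> Prop,
      [/\ is_filtration addn 0%N (fun a b => (a <= b)%N) F,
          (forall r, F 0%N r <-> L r),
          (forall a, fg_left L (F a))
        & graded_iterated_ore addn 0%N (fun a b => (a <= b)%N) F L q] in
  let cond_iii :=
    exists (x : 'I_s -> R) (le : Nn s -> Nn s -> Prop)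
           (Gam2 : 'I_s -> 'I_s -> seq (Nn s)) (Gam1 : 'I_s -> seq (Nn s)),
      admissible (@Nn_add s) (Nn_zero s) le /\
      [/\ (forall i j, uniq (Gam2 j i)) /\ (forall k, uniq (Gam1 k)),
          (forall i j : 'I_s, (i < j)%N -> forall g, g \in Gam2 j i ->
             strict le g (Nn_add (Nn_eps i) (Nn_eps j))) /\
          (forall k g, g \in Gam1 k -> strict le g (Nn_eps k)),
          (* standard monomials form a basis of R as a left L-module *)
          (forall r, exists (S : seq (Nn s)) (c : Nn s -> R),
             (forall al, L (c al)) /\ r = \sum_(al <- S) c al * xmon x al) /\
          (forall (S : seq (Nn s)) (c : Nn s -> R), uniq S ->
             (forall al, L (c al)) -> \sum_(al <- S) c al * xmon x al = 0 ->
             forall al, al \in S -> c al = 0),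
          (forall i j : 'I_s, (i < j)%N -> exists c : Nn s -> R,
             (forall al, L (c al)) /\
             x j * x i = q j i * x i * x j + \sum_(al <- Gam2 j i) c al * xmon x al)
        & (forall (a : R) (k : 'I_s), L a -> exists (ak : R) (c : Nn s -> R),
             [/\ L ak, (forall al, L (c al)) &
                 x k * a = ak * x k + \sum_(al <- Gam1 k) c al * xmon x al])] in
  (cond_i <-> cond_ii) /\ (cond_ii <-> cond_iii).
Proof.
move=> ci cii ciii.
have i_iii : ci -> ciii.
  case=> n [le [F [adm filt F0 fg ore]]].
  exact: (graded_ore_pbw hL adm (@Nn_addI n) (admissible_wf adm) filt F0 fg ore).
have ii_iii : cii -> ciii.
  case=> F [filt F0 fg ore].
  apply: (graded_ore_pbw hL _ (@addnI) _ filt F0 fg ore).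
    split; [by move=> a; exact: leqnn | split; [|split; [|split; [|split]]]] => //.
    - by move=> a b ab ba; apply/eqP; rewrite eqn_leq ab.
    - by move=> a b c; exact: leq_trans.
    - by move=> a b; apply/orP; exact: leq_total.
    - by move=> a b c ab; rewrite leq_add2r.
  move=> n; elim: n {-2}n (leqnn n) => [|N IH] n nN; constructor=> m [mn /eqP ne].
    by move: nN mn ne; rewrite leqn0 => /eqP ->; rewrite leqn0 => /eqP ->.
  by apply: IH; lia.
have iii_ii : ciii -> cii.
  exact: (@pbw_graded_ore _ _ _ _ _ _ _ addn id id).
have iii_i : ciii -> ci.
  (* Condition (i) is realized with [n = 1], through the evident identification of [Nn 1] with
     [nat]. *)
  pose phi (a : Nn 1) := a ord0; pose psi n : Nn 1 := [ffun=> n].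
  have phiK : cancel phi psi by move=> a; apply/ffunP=> i; rewrite ffunE (ord1 i).
  have psiK : cancel psi phi by move=> n; rewrite /phi ffunE.
  have phiD a b : phi (Nn_add a b) = (phi a + phi b)%N by rewrite /phi ffunE.
  case/(pbw_graded_ore (add := @Nn_add 1) hL hq phiK psiK phiD) => F [filt F0 fg ore].
  exists 1%N, (phile phi), F; split=> //; exact: (phile_admissible phiK phiD).
split; last by split.
by split=> [/i_iii/iii_ii|/ii_iii/iii_i].
Qed.
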